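(* Balanced Cluster Completion admits an algorithm running in time $4^{k+o(k)}\cdot n^{\mathcal{O}(1)}$, where $n$ is the number of vertices of the input graph.
   Context: All graphs are finite and simple. A cluster graph is a graph in which every connected component is a clique. For a non-negative integer $\eta$, a graph is $\eta$-balanced if for any two connected components $H,H'$ we have $\big||V(H)|-|V(H')|\big|\le\eta$. Balanced Cluster Completion: given a cluster graph $G$ and non-negative integers $k,\eta$, decide whether there is a set $F$ of non-edges of $G$ with $|F|\le k$ such that the graph obtained from $G$ by adding $F$ is an $\eta$-balanced cluster graph. *)

(* Defs.v *)
From mathcomp Require Import all_boot all_order all_algebra.
Set Implicit Arguments.
Unset Strict Implicit.
Unset Printing Implicit Defensive.

Record sgraph (T : finType) := SGraph {
  adj :> rel T;
  adj_sym : symmetric adj;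
  adj_irr : irreflexive adj
}.

Section Graphs.
Variable T : finType.
Implicit Types (G : sgraph T) (F : {set {set T}}).

Definition components G : {set {set T}} :=
  [set [set v | connect G u v] | u : T].

Definition clique G (A : {set T}) : Prop :=
  forall u v, u \in A -> v \in A -> u != v -> adj G u v.

Definition cluster_graph G : Prop :=
  forall H, H \in components G -> clique G H.

Definition balanced (eta : nat) G : Prop :=
  forall H H', H \in components G -> H' \in components G ->
    (absz (#|H|%:Z - #|H'|%:Z)%R <= eta)%N.

(* An undirected pair is a two-element set of vertices. *)
Definition nonedges G : {set {set T}} :=
  [set [set p.1; p.2] | p : T * T & (p.1 != p.2) && ~~ adj G p.1 p.2].

Definition add_rel G F : rel T :=
  fun u v => adj G u v || ((u != v) && ([set u; v] \in F)).

Lemma add_rel_sym G F : symmetric (add_rel G F).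
Proof. by move=> u v; rewrite /add_rel adj_sym eq_sym setUC. Qed.

Lemma add_rel_irr G F : irreflexive (add_rel G F).
Proof. by move=> u; rewrite /add_rel adj_irr eqxx. Qed.

Definition add_edges G F : sgraph T :=
  SGraph (add_rel_sym G F) (add_rel_irr G F).

Definition balanced_cluster_completion G (k eta : nat) : Prop :=
  exists F : {set {set T}},
    [/\ F \subset nonedges G, #|F| <= k,
        cluster_graph (add_edges G F) & balanced eta (add_edges G F)].

End Graphs.

(* Uniform-cost RAM over natural numbers whose only arithmetic is addition,
   truncated subtraction and halving (no multiplication, which under uniform
   cost would make the machine unrealistically powerful).  Registers are
   addressed by constants of the program; memory cells are reached only
   indirectly, through an address held in a register. *)

Inductive instr : Type :=
| IConst of nat & nat         (* r[d] := c          *)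
| ICopy of nat & nat          (* r[d] := r[a]       *)
| IAdd of nat & nat & nat     (* r[d] := r[a] + r[b] *)
| ISub of nat & nat & nat     (* r[d] := r[a] - r[b] *)
| IHalf of nat & nat          (* r[d] := r[a] / 2   *)
| ILoad of nat & nat          (* r[d] := mem[r[a]]  *)
| IStore of nat & nat         (* mem[r[a]] := r[b]  *)
| IJump of nat                (* goto l             *)
| IJumpZ of nat & nat         (* if r[a] = 0 goto l *)
| IHalt.

Definition program := seq instr.

Record config := Config {
  pc : nat;
  reg : nat -> nat;
  mem : nat -> nat
}.

Definition upd (m : nat -> nat) (a x : nat) : nat -> nat :=
  fun b => if b == a then x else m b.

(* Running past the end of the program counts as halting. *)
Definition current (P : program) (s : config) : instr := nth IHalt P (pc s).

Definition halted (P : program) (s : config) : Prop := current P s = IHalt.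

Definition step (P : program) (s : config) : config :=
  let: Config i r m := s in
  let set_reg d x := Config i.+1 (upd r d x) m in
  match current P s with
  | IConst d c => set_reg d c
  | ICopy d a => set_reg d (r a)
  | IAdd d a b => set_reg d (r a + r b)
  | ISub d a b => set_reg d (r a - r b)
  | IHalf d a => set_reg d (r a)./2
  | ILoad d a => set_reg d (m (r a))
  | IStore a b => Config i.+1 r (upd m (r a) (r b))
  | IJump l => Config l r m
  | IJumpZ a l => Config (if r a == 0 then l else i.+1) r m
  | IHalt => s
  end.

(* Started in s0, P halts after at most t steps with answer b in register 0. *)
Definition answers_in (P : program) (s0 : config) (t : nat) (b : bool) : Prop :=
  let s := iter t (step P) s0 in halted P s /\ reg s 0 = nat_of_bool b.

(* The instance (G, k, eta): n, k, eta in registers 0, 1, 2 and the adjacency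
   matrix of G, row by row, in memory cells 0, ..., n^2 - 1; all else is 0. *)
Definition input n (G : sgraph 'I_n) (k eta : nat) : config :=
  Config 0
    (nth 0 [:: n; k; eta])
    (fun a => nat_of_bool
       [exists u : 'I_n, exists v : 'I_n, (a == u * n + v) && adj G u v]).

Definition little_o_id (f : nat -> nat) : Prop :=
  forall eps : rat, (0 < eps)%R ->
    exists K : nat, forall k : nat, K <= k -> ((f k)%:R <= eps * k%:R)%R.

(* Main.v *)
Require Import Defs.
From mathcomp Require Import all_boot all_order all_algebra.
From mathcomp Require Import zify.

(** Only the sizes of the cliques of a cluster graph matter, and a completion
    merges them into groups.  A group of at least two cliques with [S] vertices
    in total costs at least [S - 1] edges, so a solution of cost at most [k] is
    described by at most [k] base-4 digits, one for each vertex of a merged group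
    except the first one: one bit tells whether the vertex starts a new clique
    of the group, the other whether it is the last vertex of the group.  The
    machine tries all [4 ^ k] certificates and checks each of them in time
    polynomial in [n] and [k]; the factor polynomial in [k] is
    [4 ^ O(log k)]. *)

Set Implicit Arguments.
Unset Strict Implicit.
Unset Printing Implicit Defensive.

(** * Merging lists of clique sizes *)

(** Skipping the first vertex of each group is what keeps the certificate at [k] digits: [k] merges
    of two isolated vertices cost [k] edges but involve [2k] vertices, and one digit per vertex
    would give [16 ^ k] certificates. The cost is handled through squares. In a cluster graph the
    component of a vertex has its degree plus one elements, so by the handshake identity the sum of
    the squared component sizes grows by exactly twice the number of added edges. The machine has
    neither multiplication nor general division, which shapes the data: the table of sizes counts
    vertices instead of cliques, so that every row of the adjacency matrix adds one to one entry,
    and edges are charged vertex by vertex. Cliques that stay unmerged need no digits; they are what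
    is left in the table, and they enter only the final comparison of the largest and the smallest
    group. *)

Definition sqsum (l : seq nat) : nat := sumn [seq x * x | x <- l].

Lemma sqsum_cat l1 l2 : sqsum (l1 ++ l2) = sqsum l1 + sqsum l2.
Proof. by rewrite /sqsum map_cat sumn_cat. Qed.

Lemma sqsum_cons x l : sqsum (x :: l) = x * x + sqsum l.
Proof. by []. Qed.

Lemma sqsum0 : sqsum [::] = 0.
Proof. by []. Qed.

Lemma sqsum1 x : sqsum [:: x] = x * x.
Proof. exact: addn0. Qed.

Lemma perm_sqsum l1 l2 : perm_eq l1 l2 -> sqsum l1 = sqsum l2.
Proof. by move=> p12; apply/perm_sumn/perm_map. Qed.

Lemma sqsum_le l : sqsum l <= sumn l * sumn l.
Proof. elim: l => //= x l IH; rewrite sqsum_cons; nia. Qed.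

(* A group of at least two cliques with [S] vertices needs at least [S - 1]
   new edges. *)
Lemma group_cost g : all (leq 1) g -> 1 < size g ->
  sqsum g + (sumn g).-1.*2 <= sumn g * sumn g.
Proof.
case: g => [|a [|b g]] //= /and3P[a0 b0 _] _.
have := sqsum_le (b :: g); rewrite (sqsum_cons a) /=.
move: (b + sumn g) (sqsum (b :: g)) (leq_addr (sumn g) b) => S Q bS QS.
have [a' ->] : exists a', a = a'.+1 by exists a.-1; lia.
have [S' ES] : exists S', S = S'.+1 by exists S.-1; lia.
by rewrite ES in QS *; nia.
Qed.

(** The bound [k.*2] counts each new edge from both ends. *)
Definition merging (sizes : seq nat) (k eta : nat) (gs : seq (seq nat)) : Prop :=
  [/\ perm_eq (flatten gs) sizes, [::] \notin gs,
      sqsum (map sumn gs) <= sqsum sizes + k.*2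
    & {in gs &, forall g h, sumn g <= sumn h + eta}].

(* [vW s] is the number of vertices lying in unused cliques of size [s], hence a
   multiple of [s].  The current group has [vP] vertices in cliques already
   taken from [vW], and [vs] vertices of its last clique have been read.  All
   closed groups have sizes in [vmn, vmx].  The certificate is refuted once
   [vbad] is nonzero. *)
Record vstate := VState {
  vW : nat -> nat; vP : nat; vs : nat; vcost : nat;
  vmn : nat; vmx : nat; vbad : nat }.

(** As [W s] is a multiple of [s], the truncated difference [s - W s] vanishes for positive [s]
    exactly when a clique of size [s] is still available. *)
Definition use_clique st :=
  let: VState W P s c mn mx bad := st in
  VState (upd W s (W s - s)) (P + s) 0 c mn mx (bad + (s - W s)).

(** The vertex read is joined to the [P] vertices of the earlier cliques of its group, so products
    of sizes arise by repeated addition. *)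
Definition next_vertex st :=
  let: VState W P s c mn mx bad := st in VState W P s.+1 (c + P) mn mx bad.

(** Taking the last clique makes [P] the size of the whole group. The counter restarts at 1 for the
    first vertex of the next group, which has no digit. *)
Definition close_group st :=
  let: VState W P s c mn mx bad := use_clique st in
  VState W 0 1 c (minn mn P) (maxn mx P) bad.

(* The low bit of the digit starts a new clique, the high bit ends the group.
   Trailing zero digits only increase [vs], so that every certificate can be
   padded to [k] digits. *)
Definition digit st y :=
  let st' := next_vertex (if odd y then use_clique st else st) in
  if odd y./2 then close_group st' else st'.

Fixpoint scan k st y :=
  if k is k'.+1 then scan k' (digit st y) y./2./2 else st.

Fixpoint extremes (W : nat -> nat) mn mx i : nat * nat :=
  if i is i'.+1 then
    if W i == 0 then extremes W mn mx i'
    else extremes W (minn mn i) (maxn mx i) i'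
  else (mn, mx).

(** The values [n] and 0 are neutral for minimum and maximum, because no group has more than [n]
    vertices. *)
Definition start n W := VState W 0 1 0 n 0 0.

(** Each summand is a defect that vanishes exactly when its condition holds; a nonzero [vP] signals
    a group left open. *)
Definition accepts n k eta W y : bool :=
  let st := scan k (start n W) y in
  let e := extremes (vW st) (vmn st) (vmx st) n in
  vbad st + vP st + (vcost st - k) + (e.2 - e.1 - eta) == 0.

(** Characterising the minimum by its lower bounds serves both directions: soundness takes the
    minimum itself as bound, completeness a prescribed window. *)
Lemma extremes_min W mn mx i b :
  (b <= (extremes W mn mx i).1) <->
  b <= mn /\ (forall j, 0 < j <= i -> W j != 0 -> b <= j).
Proof.
elim: i mn mx => [|i IH] mn mx /=.
  by split=> [bm|[]//]; split=> // j; lia.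
case: eqP => Wi; rewrite IH; split=> -[bm H]; split=> //.
- move=> j ji Wj; apply: H => //; have : j != i.+1 by apply: contraNneq Wj => ->; apply/eqP.
  by lia.
- by move=> j ji; apply: H; lia.
- by move: bm; rewrite leq_min => /andP[].
- move=> j ji Wj; have [->|ne] := eqVneq j i.+1; last by apply: H => //; lia.
  by move: bm; rewrite leq_min => /andP[].
- by rewrite leq_min bm H //; [lia | apply/eqP].
- by move=> j ji; apply: H; lia.
Qed.

Lemma extremes_max W mn mx i b :
  ((extremes W mn mx i).2 <= b) <->
  mx <= b /\ (forall j, 0 < j <= i -> W j != 0 -> j <= b).
Proof.
elim: i mn mx => [|i IH] mn mx /=.
  by split=> [bm|[]//]; split=> // j; lia.
case: eqP => Wi; rewrite IH; split=> -[bm H]; split=> //.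
- move=> j ji Wj; apply: H => //; have : j != i.+1 by apply: contraNneq Wj => ->; apply/eqP.
  by lia.
- by move=> j ji; apply: H; lia.
- by move: bm; rewrite geq_max => /andP[].
- move=> j ji Wj; have [->|ne] := eqVneq j i.+1; last by apply: H => //; lia.
  by move: bm; rewrite geq_max => /andP[].
- by rewrite geq_max bm H //; [lia | apply/eqP].
- by move=> j ji; apply: H; lia.
Qed.

(** * Soundness: an accepted certificate describes a merging *)

Section Soundness.
Variable W0 : nat -> nat.

(* [gs] are the closed groups, and [cur] the cliques already taken for the
   current group. *)
Definition traces st gs cur : Prop :=
  let: VState W P s c mn mx bad := st in
  bad = 0 ->
  [/\ forall j, W j + j * count_mem j (flatten gs ++ cur) = W0 j,
      P = sumn cur,
      c.*2 + sqsum (flatten gs ++ cur) = sqsum (map sumn gs) + P * P + (P * s).*2,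
      {in gs, forall g, mn <= sumn g <= mx}
    & ([::] \notin gs) && all (leq 1) (flatten gs ++ cur)].

(** The pending term [(P * s).*2] of the invariant is the mixed term of [(P + s) * (P + s)], so
    taking the clique preserves the cost equation without a further charge. *)
Lemma traces_use st gs cur : 0 < vs st ->
  traces st gs cur -> traces (use_clique st) gs (rcons cur (vs st)).
Proof.
case: st => W P s c mn mx bad /= s0 tr b0.
have sW : s <= W s by lia.
have [|HW HP Hc Hm /andP[Hn Ha]] := tr; first by lia.
rewrite -cats1 catA; split=> //.
- move=> j; rewrite count_cat /= /upd -(HW j); case: (eqVneq j s) => [->|js]; lia.
- by rewrite sumn_cat /= -HP; lia.
- by rewrite sqsum_cat sqsum1 muln0; nia.
- by rewrite Hn all_cat Ha /= s0.
Qed.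

Lemma traces_next st gs cur :
  traces st gs cur -> traces (next_vertex st) gs cur.
Proof.
case: st => W P s c mn mx bad /= tr b0.
by have [//|HW HP Hc Hm Ha] := tr; split=> //; nia.
Qed.

Lemma traces_close st gs cur : 0 < vs st ->
  traces st gs cur -> exists gs', traces (close_group st) gs' [::].
Proof.
move=> s0 tr; exists (rcons cur (vs st) :: gs).
have := traces_use s0 tr; case: st {s0 tr} => W P s c mn mx bad /= tr b0.
have [//|HW HP Hc Hm /andP[Hn Ha]] := tr.
have Hp : perm_eq ((rcons cur s ++ flatten gs) ++ [::]) (flatten gs ++ rcons cur s).
  by rewrite cats0 perm_catC.
split=> //.
- by move=> j; rewrite (permP Hp) HW.
- by rewrite (perm_sqsum Hp) sqsum_cons Hc -HP; lia.
- move=> g; rewrite inE => /predU1P[->|/Hm]; last by lia.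
  by rewrite -HP; lia.
- rewrite (perm_all _ Hp) Ha andbT inE negb_or Hn andbT.
  by case: (cur).
Qed.

Lemma traces_digit st gs cur y : 0 < vs st -> traces st gs cur ->
  0 < vs (digit st y) /\ exists gs' cur', traces (digit st y) gs' cur'.
Proof.
move=> s0 tr; rewrite /digit.
set st1 := next_vertex _.
have s1 : 0 < vs st1 by rewrite /st1; case: (if odd y then _ else _).
have [cur1 tr1] : exists cur1, traces st1 gs cur1.
  rewrite /st1; case: odd; last by exists cur; apply: traces_next.
  by exists (rcons cur (vs st)); apply: traces_next; apply: traces_use.
case: odd; last by split=> //; exists gs, cur1.
split; first by case: (st1).
by have [gs' tr'] := traces_close s1 tr1; exists gs', [::].
Qed.

Lemma traces_scan k st gs cur y : 0 < vs st -> traces st gs cur ->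
  exists gs' cur', traces (scan k st y) gs' cur'.
Proof.
elim: k st gs cur y => [|k IH] st gs cur y s0 tr /=; first by exists gs, cur.
by have [s1 [gs' [cur' tr']]] := traces_digit y s0 tr; apply: IH tr'.
Qed.

End Soundness.

Lemma accepts_sound n k eta W y sizes :
  (forall j, W j = j * count_mem j sizes) ->
  all (leq 1) sizes -> sumn sizes = n ->
  accepts n k eta W y -> exists gs, merging sizes k eta gs.
Proof.
move=> HW0 pos sn; rewrite /accepts.
have [gs [cur]] : exists gs cur, traces W (scan k (start n W) y) gs cur.
  apply: (@traces_scan W k (start n W) [::] [::] y) => // _.
  by split=> //= j; rewrite muln0 addn0.
case: scan => V P s c mn mx bad /= tr; rewrite !addn_eq0 -!andbA.
case/and4P=> /eqP b0 /eqP P0 ck.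
have [//|HV HP Hc Hm /andP[Hn Ha]] := tr.
have cur0 : cur = [::].
  case: cur Ha HP {tr HV Hc} => // a l; rewrite all_cat /= => /and3P[_ a0 _].
  by rewrite P0; lia.
rewrite {}cur0 !cats0 in HV Hc Ha.
have [rest] : exists rest, perm_eq sizes (flatten gs ++ rest).
  (* The table bounds multiplicities times sizes. Cancelling the size requires it to be positive,
     and size 0 does not occur in the groups. *)
  have /count_subseqP[l sub pl] : forall x, count_mem x (flatten gs) <= count_mem x sizes.
    move=> [|x]; last by rewrite -(leq_pmul2l (ltn0Sn x)) -HW0 -HV leq_addl.
    rewrite (_ : count_mem 0 _ = 0) //; apply/count_memPn/negP => /(allP Ha).
    by [].
  have [rest pr] := perm_to_subseq sub; exists rest.
  by rewrite (perm_trans pr) // perm_cat2r perm_sym.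
move=> pr.
have restP j : j \in rest -> [/\ 0 < j, j <= n & V j != 0].
  move=> jr; have js : j \in sizes by rewrite (perm_mem pr) mem_cat jr orbT.
  have j0 := allP pos _ js; split=> //.
    rewrite -sn; have := perm_sumn (perm_to_rem js) => -> /=; lia.
  have := HV j; rewrite HW0 (permP pr) count_cat mulnDr => /eqP.
  rewrite addnC eqn_add2l => /eqP ->; rewrite muln_eq0 negb_or -lt0n j0 /=.
  by rewrite -lt0n -has_count has_pred1.
(* With the computed extremes themselves as bounds, all closed groups and all leftover cliques lie
   between them; the leftover cliques become groups of their own. *)
set e := extremes _ _ _ _ => me.
have /extremes_min[e1 E1] : e.1 <= (extremes V mn mx n).1 by [].
have /extremes_max[e2 E2] : (extremes V mn mx n).2 <= e.2 by [].
have all_e g : g \in gs ++ [seq [:: j] | j <- rest] -> e.1 <= sumn g <= e.2.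
  rewrite mem_cat => /orP[/Hm|/mapP[j /restP[j0 jn Vj] ->]]; first by lia.
  by rewrite /= addn0 E1 ?E2 //; lia.
have fl1 : flatten [seq [:: j] | j <- rest] = rest.
  by elim: (rest) => //= a l ->.
have su1 : [seq sumn g | g <- [seq [:: j] | j <- rest]] = rest.
  by elim: (rest) => //= a l ->; rewrite addn0.
exists (gs ++ [seq [:: j] | j <- rest]); split.
- by rewrite flatten_cat fl1 perm_sym.
- by rewrite mem_cat negb_or Hn /=; apply/mapP => -[].
- rewrite map_cat su1 sqsum_cat (perm_sqsum pr) sqsum_cat.
  move: Hc; rewrite P0 !mul0n.
  by move: (sqsum (map sumn gs)) (sqsum (flatten gs)) (sqsum rest) => a b d; lia.
- by move=> g h /all_e g1 /all_e h1; lia.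
Qed.

(** * Completeness: a merging of bounded cost yields a certificate *)

Section Completeness.

Definition reaches m st (Q : vstate -> Prop) : Prop :=
  exists2 y, y < 4 ^ m & Q (scan m st y).

Lemma reaches_digit m st d Q : d < 4 ->
  reaches m (digit st d) Q -> reaches m.+1 st Q.
Proof.
move=> d4 [y ym HQ]; exists (d + y * 4); first by rewrite expnS; lia.
have -> : scan m.+1 st (d + y * 4) = scan m (digit st d) y; last by [].
have h1 : (d + y * 4)./2 = d./2 + y.*2 by lia.
have h2 : (d + y * 4)./2./2 = y by lia.
rewrite /= h2 /digit h1 !oddD odd_double oddM andbF !addbF.
by [].
Qed.

Lemma reaches0 m st (Q : vstate -> Prop) :
  vP st = 0 ->
  (forall s, Q (VState (vW st) 0 s (vcost st) (vmn st) (vmx st) (vbad st))) ->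
  reaches m st Q.
Proof.
move=> P0 HQ; exists 0; first by rewrite expn_gt0.
elim: m st P0 HQ => [|m IH] [W P s c mn mx bad] /= P0 HQ; rewrite P0 //.
by apply: IH => //= s'; rewrite addn0.
Qed.

Variables (lo hi : nat).

(* The group under construction consists of used cliques with [vP] vertices, of
   a clique of which [vs] out of [vs + t] vertices have been read, and of the
   cliques [l] still to come. *)
Lemma reaches_group m st t l j Q :
  t + sumn l = m.+1 -> all (leq 1) l -> 0 < vs st ->
  vbad st = 0 -> vmx st <= hi -> lo <= vmn st ->
  lo <= vP st + vs st + t + sumn l <= hi ->
  (forall i, i * count_mem i (vs st + t :: l) <= vW st i) ->
  (forall W c mn mx,
     (forall i, W i + i * count_mem i (vs st + t :: l) = vW st i) ->
     let S := vP st + vs st + t + sumn l in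
     c.*2 + sqsum (vs st + t :: l) + vP st * vP st + (vP st * vs st).*2 =
       (vcost st).*2 + S * S ->
     lo <= mn -> mx <= hi ->
     reaches j (VState W 0 1 c mn mx 0) Q) ->
  reaches (m.+1 + j) st Q.
Proof.
elim: m st t l => [|m IH] st t l.
  case: st => W P s c mn mx bad /= tl pl s0 b0 mxh lom Sb HW HQ.
  (* The final vertex either ends the current clique (digit 2) or is a clique of size one (digit
     3). *)
  have [[t1 l0]|[t0 l1]] : (t = 1 /\ l = [::]) \/ (t = 0 /\ l = [:: 1]).
    case: l tl pl {HW HQ Sb} => [|a [|b l]] /= tl pl; first by left; split=> //; lia.
      by right; have [-> ->] : t = 0 /\ a = 1 by lia.
    by case/and3P: pl => a1 b1 _; lia.
  - subst t l bad; apply: (@reaches_digit _ _ 2) => //.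
    rewrite /digit /close_group /= ?add0n.
    have sW : s.+1 <= W s.+1 by have := HW s.+1; rewrite addn1 eqxx; lia.
    rewrite (eqP (_ : s.+1 - W s.+1 == 0)) ?subn_eq0 //.
    apply: HQ => /=.
    + by move=> i; rewrite /upd addn1; case: (eqVneq i s.+1) => [->|_] /=; lia.
    + by rewrite !sqsum_cons sqsum0 /=; nia.
    + by rewrite /= in Sb; lia.
    + by rewrite /= in Sb; lia.
  subst t l bad; apply: (@reaches_digit _ _ 3) => //.
  rewrite /digit /close_group /= ?add0n.
  have sW : s <= W s.
    by have := HW s; rewrite addn0 eqxx; nia.
  rewrite (eqP (_ : s - W s == 0)) ?subn_eq0 //.
  (* If the clique just taken is also a singleton, the multiset hypothesis provides two of them. *)
  have W1 : 1 <= upd W s (W s - s) 1.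
    rewrite /upd; case: eqP => [s1|s1]; have := HW 1; rewrite addn0 /= ?eqxx.
      by rewrite -s1 eqxx; lia.
    by rewrite /=; lia.
  rewrite (eqP (_ : 1 - _ == 0)) ?subn_eq0 //.
  apply: HQ => /=.
  + move=> i; have := HW i; rewrite /upd addn0 /= [s == i]eq_sym [1 == i]eq_sym.
    by case: (eqVneq i 1) => [->|i1]; 
      [case: (eqVneq 1 s) => [<-|s1]|case: (eqVneq i s) => [->|s1]];
      rewrite /= ?eqxx; lia.
  + by rewrite !sqsum_cons sqsum0 /=; nia.
  + by rewrite /= in Sb; lia.
  + by rewrite /= in Sb; lia.
case: st => W P s c mn mx bad /= tl pl s0 b0 mxh lom Sb HW HQ; subst bad.
case: t tl Sb HW HQ => [|t] tl Sb HW HQ.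
  case: l pl tl Sb HW HQ => [|a l] /= pl tl Sb HW HQ; first by lia.
  case/andP: pl => a0 pl.
  (* The current clique is complete: digit 1 takes it and reads the first vertex of [a], leaving
     [a.-1]. *)
  apply: (@reaches_digit _ _ 1) => //; rewrite /digit /close_group /= ?add0n.
  have sW : s <= W s by have := HW s; rewrite addn0 eqxx; nia.
  rewrite (eqP (_ : s - W s == 0)) ?subn_eq0 //.
  have a1 : 1 + a.-1 = a by lia.
  apply: (IH _ a.-1 l) => //=; rewrite ?a1; try lia.
  + move=> i; have := HW i; rewrite /upd addn0 [s == i]eq_sym.
    by case: (eqVneq i s) => [->|js]; lia.
  + move=> W' c' mn' mx' HW' Hc lom' mxh'; apply: HQ => //.
      move=> i; have := HW' i; have := HW i; rewrite /upd addn0 [s == i]eq_sym.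
      by case: (eqVneq i s) => [->|js]; lia.
    by move: Hc; rewrite !sqsum_cons -/(sqsum l) addn0; move: (sqsum l) (sumn l) a1 => q r a1; nia.
apply: (@reaches_digit _ _ 0) => //; rewrite /digit /close_group /= ?add0n.
have st1 : s.+1 + t = s + t.+1 by lia.
apply: (IH _ t l) => //=; rewrite ?st1; try lia; try by [].
move=> W' c' mn' mx' HW' Hc lom' mxh'; apply: HQ => //.
by move: Hc; rewrite !sqsum_cons -/(sqsum l); move: (sqsum l) (sumn l) => q r; nia.
Qed.

(** A group with [S] vertices uses [S - 1] digits, and closing it leaves a state ready for the next
    group. The [j] spare digits are left to the continuation. *)
Lemma reaches_groups gs j W c mn mx Q :
  all (fun g => all (leq 1) g && (1 < size g)) gs ->
  mx <= hi -> lo <= mn -> {in gs, forall g, lo <= sumn g <= hi} ->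
  (forall i, i * count_mem i (flatten gs) <= W i) ->
  (forall W' c' mn' mx',
     (forall i, W' i + i * count_mem i (flatten gs) = W i) ->
     c'.*2 + sqsum (flatten gs) = c.*2 + sqsum (map sumn gs) ->
     lo <= mn' -> mx' <= hi ->
     reaches j (VState W' 0 1 c' mn' mx' 0) Q) ->
  reaches (sumn [seq (sumn g).-1 | g <- gs] + j) (VState W 0 1 c mn mx 0) Q.
Proof.
elim: gs W c mn mx => [|g gs IH] W c mn mx /= pos mxh lom Hg HW HQ.
  by apply: HQ => // i; rewrite muln0 addn0.
case/andP: pos => /andP[pg g1] pos.
case: g pg g1 Hg HW HQ => [|a g] //= /andP[a0 pg] g1 Hg HW HQ.
have gs0 : 0 < sumn g.
  by case: g pg g1 {HQ Hg HW} => //= b l /andP[b0 _] _; lia.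
rewrite -addnA (_ : (a + sumn g).-1 = (a.-1 + sumn g).-1.+1); last by lia.
have Sg : 1 + a.-1 + sumn g = a + sumn g by lia.
apply: (@reaches_group _ _ a.-1 g) => //=; rewrite ?add0n ?add1n ?prednK ?muln1 //; try lia.
- exact: (Hg (a :: g) (mem_head _ _)).
- by move=> i; have := HW i; rewrite count_cat mulnDr; lia.
move=> W' c' mn' mx' HW' Hc lom' mxh'; apply: IH => //.
- by move=> h hg; apply: Hg; rewrite inE hg orbT.
- by move=> i; have := HW i; rewrite -HW' count_cat !mulnDr;
    move: (i * (a == i)) (i * count_mem i g) (i * count_mem i (flatten gs)) => x y z; lia.
move=> W'' c'' mn'' mx'' HW'' Hc''; apply: HQ.
  by move=> i; rewrite count_cat -HW' -HW'' !mulnDr;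
    move: (i * (a == i)) (i * count_mem i g) (i * count_mem i (flatten gs)) => x y z; lia.
move: Hc Hc''; rewrite -cat_cons sqsum_cat !sqsum_cons; lia.
Qed.

End Completeness.

Lemma accepts_complete n k eta W sizes gs :
  (forall j, W j = j * count_mem j sizes) ->
  all (leq 1) sizes -> sumn sizes = n ->
  merging sizes k eta gs -> exists2 y, y < 4 ^ k & accepts n k eta W y.
Proof.
move=> HW pos sn [pgs n0 cost bal].
(* Only groups of at least two cliques receive digits; the others stay in the table. *)
pose big := [seq g <- gs | 1 < size g].
pose single := [seq g <- gs | ~~ (1 < size g)].
have pbs : perm_eq gs (big ++ single) by rewrite perm_sym; apply/permPl/perm_filterC.
have single1 g : g \in single -> exists j, g = [:: j].
  rewrite mem_filter => /andP[]; case: g => [|a [|b g]] //= _; last by exists a.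
  by rewrite (negPf n0).
have flat : perm_eq sizes (flatten big ++ flatten single).
  by rewrite -flatten_cat perm_sym (perm_trans _ pgs) // perm_flatten // perm_sym.
have su1 : map sumn single = flatten single.
  elim: (single) single1 => //= g l IH H; rewrite IH; last by move=> h hl; apply: H; rewrite inE hl orbT.
  by have [j ->] := H g (mem_head _ _); rewrite /= addn0.
have sum_gs : sqsum (map sumn gs) = sqsum (map sumn big) + sqsum (flatten single).
  by rewrite (perm_sqsum (perm_map _ pbs)) map_cat sqsum_cat su1.
have pos_big : all (fun g => all (leq 1) g && (1 < size g)) big.
  apply/allP=> g gb; have := gb; rewrite mem_filter => /andP[-> ggs]; rewrite andbT.
  apply/allP=> x xg; apply: (allP pos); rewrite (perm_mem flat) mem_cat.
  by apply/orP; left; apply/flattenP; exists g.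
have costs l : all (fun g => all (leq 1) g && (1 < size g)) l ->
    sqsum (flatten l) + (sumn [seq (sumn g).-1 | g <- l]).*2 <= sqsum (map sumn l).
  elim: l => //= g l IH /andP[/andP[pg g1] /IH]; rewrite sqsum_cat sqsum_cons.
  by have := group_cost pg g1; lia.
(* By balance, all group sizes lie in the window from [hi - eta] to [hi]. *)
pose hi := \max_(g <- gs) sumn g.
have hiP g : g \in gs -> sumn g <= hi by move=> gg; apply: (leq_bigmax_seq (F := sumn)).
have lohi g : g \in gs -> hi - eta <= sumn g <= hi.
  move=> gg; rewrite hiP // andbT leq_subLR addnC.
  by apply/bigmax_leqP_seq => h hh _; apply: bal.
have hin : hi <= n.
  apply/bigmax_leqP_seq => g gg _; rewrite -sn -(perm_sumn pgs).
  by elim: (gs) gg => //= h l IH; rewrite inE sumn_cat => /predU1P[->|/IH]; lia.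
have := @reaches_groups (hi - eta) hi big (k - sumn [seq (sumn g).-1 | g <- big])
  W 0 n 0 (fun st => let e := extremes (vW st) (vmn st) (vmx st) n in
  vbad st + vP st + (vcost st - k) + (e.2 - e.1 - eta) == 0).
rewrite subnKC; last by have := costs _ pos_big; rewrite sum_gs (perm_sqsum flat) sqsum_cat in cost; lia.
apply=> //.
- by lia.
- by move=> g; rewrite mem_filter => /andP[_ /lohi].
- by move=> i; rewrite HW (permP flat) count_cat mulnDr leq_addr.
move=> W' c' mn' mx' HW' Hc lom mxh; apply: reaches0 => //= _.
rewrite !add0n addn_eq0 !subn_eq0.
(* A nonzero entry left in the table comes from a clique forming a group by itself, so its size lies
   in the window too. *)
have Wj j : 0 < j -> W' j != 0 -> hi - eta <= j <= hi.
  move=> j0; have := HW' j; rewrite HW (permP flat) count_cat mulnDr => /eqP.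
  rewrite addnC eqn_add2l => /eqP ->; rewrite muln_eq0 negb_or => /andP[_].
  rewrite -lt0n -has_count has_pred1 => /flattenP[g gsing jg].
  have [i Eg] := single1 _ gsing; subst g; move: jg; rewrite inE => /eqP ->.
  have : [:: i] \in gs by move: gsing; rewrite mem_filter => /andP[].
  by move/lohi; rewrite /= addn0.
have /extremes_min H1 : hi - eta <= mn' /\ (forall j, 0 < j <= n -> W' j != 0 -> hi - eta <= j).
  by split=> // j /andP[j0 _] /(Wj _ j0) /andP[].
have /extremes_max H2 : mx' <= hi /\ (forall j, 0 < j <= n -> W' j != 0 -> j <= hi).
  by split=> // j /andP[j0 _] /(Wj _ j0) /andP[].
apply/andP; split.
  rewrite sum_gs (perm_sqsum flat) sqsum_cat in cost; lia.
by have := H1 mx'; have := H2 mn'; lia.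
Qed.

(** * Structured programs *)

Inductive cmd : Type :=
| Block of seq instr
| Seq of cmd & cmd
| IfNZ of nat & cmd
| WhileNZ of nat & cmd.

Definition store : Type := ((nat -> nat) * (nat -> nat))%type.

Definition is_jump (i : instr) : bool :=
  match i with IJump _ | IJumpZ _ _ | IHalt => true | _ => false end.

(* Convertible to [upd], which is kept for memory updates: [run_code] below
   evaluates register updates only. *)
Definition set_reg (r : nat -> nat) (d x : nat) : nat -> nat :=
  fun b => if eqn b d then x else r b.

Definition assign (s : store) (i : instr) : store :=
  let: (r, m) := s in
  match i with
  | IConst d c => (set_reg r d c, m)
  | ICopy d a => (set_reg r d (r a), m)
  | IAdd d a b => (set_reg r d (r a + r b), m)
  | ISub d a b => (set_reg r d (r a - r b), m)
  | IHalf d a => (set_reg r d (r a)./2, m)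
  | ILoad d a => (set_reg r d (m (r a)), m)
  | IStore a b => (r, upd m (r a) (r b))
  | _ => s
  end.

(** The last index is the exact number of machine steps: one for each test, and one for the jump
    back after each loop body. *)
Inductive exec : cmd -> store -> store -> nat -> Prop :=
| ExecBlock l s : ~~ has is_jump l ->
    exec (Block l) s (foldl assign s l) (size l)
| ExecSeq c1 c2 s1 s2 s3 t1 t2 :
    exec c1 s1 s2 t1 -> exec c2 s2 s3 t2 -> exec (Seq c1 c2) s1 s3 (t1 + t2)
| ExecIfTrue a c s s' t :
    s.1 a != 0 -> exec c s s' t -> exec (IfNZ a c) s s' t.+1
| ExecIfFalse a c s : s.1 a = 0 -> exec (IfNZ a c) s s 1
| ExecWhileTrue a c s1 s2 s3 t1 t2 :
    s1.1 a != 0 -> exec c s1 s2 t1 -> exec (WhileNZ a c) s2 s3 t2 ->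
    exec (WhileNZ a c) s1 s3 (t1 + t2).+2
| ExecWhileFalse a c s : s.1 a = 0 -> exec (WhileNZ a c) s s 1.

Fixpoint code_size (c : cmd) : nat :=
  match c with
  | Block l => size l
  | Seq c1 c2 => code_size c1 + code_size c2
  | IfNZ _ c => (code_size c).+1
  | WhileNZ _ c => (code_size c).+2
  end.

Fixpoint compile (o : nat) (c : cmd) : program :=
  match c with
  | Block l => l
  | Seq c1 c2 => compile o c1 ++ compile (o + code_size c1) c2
  | IfNZ a c => IJumpZ a (o + (code_size c).+1) :: compile o.+1 c
  | WhileNZ a c =>
      IJumpZ a (o + (code_size c).+2) :: rcons (compile o.+1 c) (IJump o)
  end.

Lemma size_compile o c : size (compile o c) = code_size c.
Proof.
elim: c o => //= [c1 IH1 c2 IH2|a c IH|a c IH] o.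
- by rewrite size_cat IH1 IH2.
- by rewrite IH.
- by rewrite size_rcons IH.
Qed.

Lemma current_at P1 i P2 r m :
  current (P1 ++ i :: P2) (Config (size P1) r m) = i.
Proof. by rewrite /current nth_cat ltnn subnn. Qed.

Lemma run_block P1 l P2 s : ~~ has is_jump l ->
  iter (size l) (step (P1 ++ l ++ P2)) (Config (size P1) s.1 s.2) =
  Config (size P1 + size l) (foldl assign s l).1 (foldl assign s l).2.
Proof.
elim: l P1 s => [|i l IH] P1 s /=; first by rewrite addn0.
rewrite negb_or => /andP[ji jl]; rewrite -iterS iterSr.
rewrite {2}/step current_at.
have -> : P1 ++ i :: l ++ P2 = rcons P1 i ++ l ++ P2 by rewrite cat_rcons.
have := IH (rcons P1 i) (assign s i) jl; rewrite size_rcons addSnnS => <-.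
by case: s i ji {IH} => r m [] //=.
Qed.

(** Jump targets are absolute, so the induction needs arbitrary surrounding code, with the length of
    the prefix as offset. *)
Lemma run_compile c s s' t : exec c s s' t -> forall P1 P2,
  iter t (step (P1 ++ compile (size P1) c ++ P2)) (Config (size P1) s.1 s.2) =
  Config (size P1 + code_size c) s'.1 s'.2.
Proof.
elim=> {c s s' t}.
- by move=> l s jl P1 P2; apply: run_block.
- move=> c1 c2 s1 s2 s3 t1 t2 _ IH1 _ IH2 P1 P2 /=.
  rewrite addnC iterD -catA IH1 catA.
  have E : size P1 + code_size c1 = size (P1 ++ compile (size P1) c1).
    by rewrite size_cat size_compile.
  by rewrite E IH2 -E addnA.
- move=> a c s s' t sa _ IH P1 P2 /=.
  rewrite -iterS iterSr {2}/step current_at (negPf sa).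
  rewrite -cat_rcons -(size_rcons P1 (IJumpZ a (size P1 + (code_size c).+1))).
  by rewrite IH size_rcons addSnnS.
- by move=> a c s sa P1 P2 /=; rewrite current_at sa.
- move=> a c s1 s2 s3 t1 t2 sa _ IH1 _ IH2 P1 P2.
  (* From right to left, the order in which [iterD] runs them: the test, the body, the jump back,
     the remaining iterations. *)
  have -> : (t1 + t2).+2 = t2 + (1 + (t1 + 1)) by lia.
  rewrite !iterD; set P := P1 ++ _ ++ P2.
  set J := IJumpZ a (size P1 + (code_size c).+2).
  have PE : P = rcons P1 J ++ compile (size (rcons P1 J)) c ++ IJump (size P1) :: P2.
    by rewrite /P /= size_rcons !cat_rcons.
  have -> : iter 1 (step P) (Config (size P1) s1.1 s1.2) = Config (size (rcons P1 J)) s1.1 s1.2.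
    by rewrite /= current_at (negPf sa) size_rcons.
  rewrite PE IH1 catA.
  have E : size (rcons P1 J) + code_size c = size (rcons P1 J ++ compile (size (rcons P1 J)) c).
    by rewrite size_cat size_compile.
  by rewrite E /= current_at -catA -PE IH2.
- by move=> a c s sa P1 P2 /=; rewrite current_at sa.
Qed.

(** * Total correctness with time bounds *)

Definition wp (c : cmd) (T : nat) (Q : store -> Prop) (s : store) : Prop :=
  exists s' t, [/\ exec c s s' t, t <= T & Q s'].

Definition target (i : instr) : option nat :=
  match i with
  | IConst d _ | ICopy d _ | IAdd d _ _ | ISub d _ _ | IHalf d _ | ILoad d _ =>
      Some d
  | _ => None
  end.

Fixpoint writes (c : cmd) : seq nat :=
  match c with
  | Block l => pmap target l
  | Seq c1 c2 => writes c1 ++ writes c2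
  | IfNZ _ c | WhileNZ _ c => writes c
  end.

(** A frame condition for registers only, decided by computing [writes]; memory is tracked by
    explicit invariants. *)
Definition agree (c : cmd) (s s' : store) : Prop :=
  forall d, d \notin writes c -> s'.1 d = s.1 d.

Lemma assign_agree s i d : target i != Some d -> (assign s i).1 d = s.1 d.
Proof.
case: s => r m.
case: i => [a b|a b|a b c|a b c|a b|a b|a b|a|a b|] //= ad; rewrite /set_reg -[eqn d a]/(d == a);
  by case: (d =P a) ad => [->|] //; rewrite eqxx.
Qed.

Lemma exec_agree c s s' t : exec c s s' t -> agree c s s'.
Proof.
elim=> {c s s' t} //=.
- move=> l s _ d; elim: l s => //= i l IH s dl.
  rewrite IH; last by apply: contra dl; case: target => //= a; rewrite inE orbC => ->.
  apply: assign_agree; apply: contraNneq dl => ->; exact: mem_head.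
- move=> c1 c2 s1 s2 s3 t1 t2 _ H1 _ H2 d; rewrite /= mem_cat negb_or => /andP[d1 d2].
  by rewrite H2 // H1.
- by move=> a c s1 s2 s3 t1 t2 _ _ H1 _ H2 d dc; rewrite H2 // H1.
Qed.

Lemma wp_block l (Q : store -> Prop) s :
  ~~ has is_jump l -> Q (foldl assign s l) -> wp (Block l) (size l) Q s.
Proof. by move=> jl HQ; exists (foldl assign s l), (size l); split=> //; constructor. Qed.

Lemma wp_le c T T' (Q : store -> Prop) s : T <= T' -> wp c T Q s -> wp c T' Q s.
Proof. by move=> TT [s' [t [ex tT HQ]]]; exists s', t; split=> //; apply: leq_trans TT. Qed.

Lemma wp_conseq c T (Q Q' : store -> Prop) s :
  (forall s', agree c s s' -> Q s' -> Q' s') -> wp c T Q s -> wp c T Q' s.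
Proof.
move=> QQ [s' [t [ex tT HQ]]]; exists s', t; split=> //.
by apply: QQ => //; apply: exec_agree ex.
Qed.

Lemma wp_seq c1 c2 T1 T2 (R Q : store -> Prop) s :
  wp c1 T1 R s -> (forall s', agree c1 s s' -> R s' -> wp c2 T2 Q s') ->
  wp (Seq c1 c2) (T1 + T2) Q s.
Proof.
move=> [s1 [t1 [ex1 tT1 HR]]] /(_ _ (exec_agree ex1) HR) [s2 [t2 [ex2 tT2 HQ]]].
by exists s2, (t1 + t2); split=> //; [apply: ExecSeq ex1 ex2 | apply: leq_add].
Qed.

Lemma wp_block_seq l c T (Q : store -> Prop) s :
  ~~ has is_jump l -> wp c T Q (foldl assign s l) ->
  wp (Seq (Block l) c) (size l + T) Q s.
Proof.
move=> jl H; apply: (wp_seq (wp_block (Q := eq (foldl assign s l)) jl _)) => //.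
by move=> s' _ <-.
Qed.

Lemma wp_if a c T (Q : store -> Prop) s :
  (s.1 a != 0 -> wp c T Q s) -> (s.1 a = 0 -> Q s) -> wp (IfNZ a c) T.+1 Q s.
Proof.
move=> H1 H2; case: (eqVneq (s.1 a) 0) => [sa|sa].
  by exists s, 1; split; [apply: ExecIfFalse|lia|apply: H2].
have [s' [t [ex tT HQ]]] := H1 sa.
by exists s', t.+1; split=> //; apply: ExecIfTrue.
Qed.

(** The invariant is indexed by the number of remaining iterations; [agree c s0 s] frees it from
    mentioning registers that the body never writes. *)
Lemma wp_for i c T (I : nat -> store -> Prop) s0 :
  (forall j s, I j.+1 s -> s.1 i = j.+1 -> agree c s0 s ->
    wp c T (fun s' => I j s' /\ s'.1 i = j) s) ->
  I (s0.1 i) s0 -> wp (WhileNZ i c) (s0.1 i * T.+2).+1 (I 0) s0.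
Proof.
move=> body I0.
have gen j s : s.1 i = j -> I j s -> agree c s0 s ->
    wp (WhileNZ i c) (j * T.+2).+1 (I 0) s.
  elim: j s => [|j IH] s si Ij ag.
    by exists s, 1; split=> //; apply: ExecWhileFalse.
  have [s1 [t1 [ex1 tT1 [I1 s1i]]]] := body _ _ Ij si ag.
  have [|s2 [t2 [ex2 tT2 I2]]] := IH s1 s1i I1.
    by move=> d dc; rewrite (exec_agree ex1) // ag.
  exists s2, (t1 + t2).+2; split=> //.
    by apply: ExecWhileTrue ex1 ex2; rewrite si.
  by move: tT2; rewrite mulSn; lia.
by apply: gen.
Qed.

(** * The machine *)

Notation "c1 ;; c2" := (Seq c1 c2) (at level 60, right associativity).

(* Registers: 0 = n, 1 = k, 2 = eta, 3 = certificate, 4 = answer, 5 = 1,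
   6 = n * n, 8 and 9 = loop counters, 10 = address, 12 = unread digits,
   13 to 18 = [vP], [vs], [vcost], [vmn], [vmx], [vbad], 20 = current bit,
   21 = row sum, 11 and 19 = scratch.  The table [vW] is stored from address
   [n * n] on. *)
Definition clear_table : cmd :=
  Block [:: ICopy 8 0] ;;
  WhileNZ 8 (Block [:: IAdd 10 6 8; IConst 11 0; IStore 10 11; ISub 8 8 5]).

(** The address in register 10 is not reset between rows, so consecutive calls walk through the
    matrix without computing [u * n]. *)
Definition count_row : cmd :=
  WhileNZ 9 (Block [:: ILoad 11 10; IAdd 21 21 11; IAdd 10 10 5; ISub 9 9 5]).

Definition fill_table : cmd :=
  Block [:: ICopy 8 0; IConst 10 0] ;;
  WhileNZ 8
    (Block [:: IConst 21 1; ICopy 9 0] ;;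
     count_row ;;
     Block [:: IAdd 19 6 21; ILoad 11 19; IAdd 11 11 5; IStore 19 11; ISub 8 8 5]).

Definition code_use : seq instr :=
  [:: IAdd 10 6 14; ILoad 11 10; ISub 19 14 11; IAdd 18 18 19;
      ISub 11 11 14; IStore 10 11; IAdd 13 13 14; IConst 14 0].

(** Truncated subtraction gives the minimum as [a - (a - b)] and the maximum as [a + (b - a)]. *)
Definition code_close : seq instr :=
  code_use ++ [:: ISub 11 16 13; ISub 16 16 11; ISub 11 13 17; IAdd 17 17 11;
                  IConst 13 0; IConst 14 1].

(** Subtracting the half twice leaves the low bit. *)
Definition code_bit : seq instr :=
  [:: IHalf 19 12; ISub 20 12 19; ISub 20 20 19; ICopy 12 19].

Definition code_digit : cmd :=
  Block code_bit ;;
  IfNZ 20 (Block code_use) ;;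
  Block ([:: IAdd 14 14 5; IAdd 15 15 13] ++ code_bit) ;;
  IfNZ 20 (Block code_close) ;;
  Block [:: ISub 8 8 5].

Definition scan_digits : cmd :=
  Block [:: ICopy 12 3; IConst 13 0; IConst 14 1; IConst 15 0; ICopy 16 0;
            IConst 17 0; IConst 18 0; ICopy 8 1] ;;
  WhileNZ 8 code_digit.

Definition find_extremes : cmd :=
  Block [:: ICopy 8 0] ;;
  WhileNZ 8
    (Block [:: IAdd 10 6 8; ILoad 11 10] ;;
     IfNZ 11 (Block [:: ISub 11 16 8; ISub 16 16 11; ISub 11 8 17; IAdd 17 17 11]) ;;
     Block [:: ISub 8 8 5]).

Definition verify : cmd :=
  clear_table ;; fill_table ;; scan_digits ;; find_extremes ;;
  Block [:: IAdd 18 18 13; ISub 11 15 1; IAdd 18 18 11; ISub 11 17 16;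
            ISub 11 11 2; IAdd 18 18 11; ISub 11 5 18] ;;
  IfNZ 11 (Block [:: IConst 4 1]).

(** [n * n] arises from [n] additions and [4 ^ k] from [2k] doublings. Certificates run from
    [4 ^ k - 1] down to 0, as the counter is decremented before each check. *)
Definition solver : cmd :=
  Block [:: IConst 5 1; ICopy 8 0] ;;
  WhileNZ 8 (Block [:: IAdd 6 6 0; ISub 8 8 5]) ;;
  Block [:: IConst 3 1; ICopy 8 1] ;;
  WhileNZ 8 (Block [:: IAdd 3 3 3; IAdd 3 3 3; ISub 8 8 5]) ;;
  WhileNZ 3 (Block [:: ISub 3 3 5] ;; verify) ;;
  Block [:: ICopy 0 4].

Ltac run_code := cbv [foldl assign fst snd set_reg eqn cat
  code_use code_close code_bit].

(** * Correctness and running time of the machine, relative to [accepts] *)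

Section Verification.
Variables (n k eta : nat) (A : nat -> nat).

Definition row_size (u : nat) : nat := (\sum_(v < n) A (u * n + v)).+1.
Definition table (u i : nat) : nat := count_mem i [seq row_size v | v <- iota 0 u].

Hypothesis row_size_le : forall u, u < n -> row_size u <= n.

Definition env (s : store) : Prop :=
  [/\ s.1 0 = n, s.1 1 = k, s.1 2 = eta, s.1 5 = 1 & s.1 6 = n * n].

Definition layout (m W : nat -> nat) : Prop :=
  (forall a, a < n * n -> m a = A a) /\ (forall j, m (n * n + j) = W j).

(** Clearing touches only the entries 1 to [n]; this condition ensures that it restores the zero
    table for the next certificate. *)
Definition supported (W : nat -> nat) : Prop :=
  forall j, ~~ (0 < j <= n) -> W j = 0.

Lemma env_agree c s s' : env s -> agree c s s' ->
  ~~ has (mem [:: 0; 1; 2; 5; 6]) (writes c) -> env s'.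
Proof.
move=> [e0 e1 e2 e5 e6] ag /hasPn nw.
have w d : d \in [:: 0; 1; 2; 5; 6] -> s'.1 d = s.1 d.
  by move=> dm; apply: ag; apply/negP => /nw; rewrite /= dm.
by split; rewrite w.
Qed.

Lemma layout_upd m W j x : layout m W -> layout (upd m (n * n + j) x) (upd W j x).
Proof.
move=> [mA mW]; split=> [a an|i]; rewrite /upd; last by rewrite eqn_add2l mW.
by rewrite (_ : (a == _) = false) ?mA //; lia.
Qed.

Lemma layout_ext m W W' : W =1 W' -> layout m W -> layout m W'.
Proof. by move=> EW [mA mW]; split=> // j; rewrite mW. Qed.

Lemma wp_clear_table s W : env s -> layout s.2 W -> supported W ->
  wp clear_table (n * 6 + 2) (fun s' => layout s'.2 (fun=> 0)) s.
Proof.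
case: s => r m [/= e0 e1 e2 e5 e6] lay sup.
apply: (@wp_le _ (1 + (n * 6).+1)); first by lia.
apply: wp_block_seq => //.
set s0 := foldl _ _ _.
have env0 : env s0 by [].
have s08 : s0.1 8 = n by [].
rewrite -{1}s08.
pose I j (s : store) := exists2 W, layout s.2 W &
  forall i, ~~ (0 < i <= j) -> W i = 0.
apply: (@wp_conseq _ _ (I 0)).
  by move=> s' _ [V lV HV]; apply: layout_ext lV => j; apply: HV; lia.
apply: wp_for; last by exists W; rewrite ?s08.
move=> j [r' m'] [V lV HV] /= r8 ag.
have [/= a0 a1 a2 a5 a6] := env_agree env0 ag isT.
apply: (@wp_block [:: _; _; _; _]) => //.
run_code; rewrite a5 a6 r8; split; last by lia.
exists (upd V j.+1 0); first exact: layout_upd.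
move=> i ij; rewrite /upd; case: eqP => // ne; apply: HV; lia.
Qed.

Lemma wp_count_row s u : env s -> u < n ->
  s.1 9 = n -> s.1 10 = u * n -> s.1 21 = 1 ->
  (forall a, a < n * n -> s.2 a = A a) ->
  wp count_row (n * 6 + 1)
    (fun s' => [/\ s'.2 = s.2, s'.1 10 = u.+1 * n & s'.1 21 = row_size u]) s.
Proof.
move=> en un s9 s10 s21 mA; rewrite -{1}s9 addn1.
pose I j (s' : store) := exists2 w, w + j = n &
  [/\ s'.2 = s.2, s'.1 10 = u * n + w & s'.1 21 = (\sum_(v < w) A (u * n + v)).+1].
apply: (@wp_conseq _ _ (I 0)).
  move=> s' _ [w]; rewrite addn0 => -> [-> -> ->].
  by split=> //; rewrite mulSn addnC.
apply: wp_for; last first.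
  by exists 0; rewrite ?s9 ?s10 ?s21 ?addn0 // big_ord0.
move=> j [r m] [w wn [/= ms r10 r21]] /= r9 ag.
have [/= a0 a1 a2 a5 a6] := env_agree en ag isT.
apply: (@wp_block [:: _; _; _; _]) => //.
rewrite /I; run_code; rewrite a5 r9; split; last by lia.
exists w.+1; first by lia.
split; rewrite ?r10 ?r21 ?a5 //; first by lia.
by rewrite big_ord_recr /= ms mA //; nia.
Qed.

Lemma wp_fill_table s : env s -> layout s.2 (fun=> 0) ->
  wp fill_table (n * (n * 6 + 10) + 3) (fun s' => layout s'.2 (table n)) s.
Proof.
case: s => r m [/= e0 e1 e2 e5 e6] lay.
apply: (@wp_le _ (2 + (n * ((2 + ((n * 6 + 1) + 5)).+2)).+1)); first by lia.
apply: wp_block_seq => //.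
set s0 := foldl _ _ _.
have env0 : env s0 by [].
have s08 : s0.1 8 = n by [].
rewrite -{1}s08.
pose I j (s : store) := exists2 u, u + j = n &
  s.1 10 = u * n /\ layout s.2 (table u).
apply: (@wp_conseq _ _ (I 0)).
  by move=> s' _ [u]; rewrite addn0 => -> [].
apply: wp_for; last by exists 0; rewrite ?s08.
move=> j [r' m'] [u un [/= r10 lu]] /= r8 ag.
have env1 := env_agree env0 ag isT.
have [/= a0 a1 a2 a5 a6] := env1.
apply: (@wp_block_seq [:: _; _]) => //.
set s1 := foldl _ _ _.
have env2 : env s1 by [].
apply: (wp_seq (R := fun s' : store => [/\ s'.2 = s1.2, s'.1 10 = u.+1 * n & s'.1 21 = row_size u])).
  by apply: wp_count_row => //; [lia|case: lu].
move=> [r2 m2] ag2 [/= -> r210 r221].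
have [/= b0 b1 b2 b5 b6] := env_agree env2 ag2 isT.
have b8 : r2 8 = j.+1 by apply: etrans (ag2 8 isT) r8.
apply: (@wp_block [:: _; _; _; _; _]) => //.
run_code; rewrite b5 b6 b8 r221; split; last by lia.
exists u.+1; first by lia.
split=> //=; rewrite ?(proj2 lu).
apply: layout_ext (layout_upd _ _ lu) => i.
rewrite /upd /table -[u.+1]addn1 iotaD map_cat count_cat /= add0n addn0 eq_sym.
by case: (eqVneq i (row_size u)) => [->|]; rewrite ?addn0.
Qed.

Definition holds st (s : store) : Prop :=
  [/\ layout s.2 (vW st), s.1 13 = vP st & s.1 14 = vs st] /\
  [/\ s.1 15 = vcost st, s.1 16 = vmn st, s.1 17 = vmx st & s.1 18 = vbad st].

Lemma holds_ext st s s' : s'.2 = s.2 ->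
  (forall d, 12 < d < 19 -> s'.1 d = s.1 d) -> holds st s -> holds st s'.
Proof.
move=> E2 E1 [[h1 h2 h3] [h4 h5 h6 h7]].
by split; split; rewrite ?E2 ?E1.
Qed.

Lemma holds_use st s : env s -> holds st s ->
  holds (use_clique st) (foldl assign s code_use).
Proof.
case: s st => r m [W P v c mn mx bad] [/= e0 e1 e2 e5 e6].
move=> [[/= lay h13 h14] [h15 h16 h17 h18]].
split; run_code; rewrite ?e6 ?h13 ?h14 ?h15 ?h16 ?h17 ?h18.
  by split=> //; have [_ ->] := lay; apply: layout_upd.
by have [_ ->] := lay.
Qed.

Lemma holds_close st s : env s -> holds st s ->
  holds (close_group st) (foldl assign s code_close).
Proof.
move=> en hs; rewrite /code_close foldl_cat /close_group.
case: (foldl assign s code_use) (holds_use en hs) => r m.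
case: (use_clique st) => W P v c mn mx bad [[/= lay h13 h14] [h15 h16 h17 h18]].
by split; run_code; rewrite ?h13 ?h14 ?h15 ?h16 ?h17 ?h18 ?minnE ?maxnE.
Qed.

Lemma wp_digit st s : env s -> holds st s ->
  wp code_digit 35
    (fun s' => [/\ holds (digit st (s.1 12)) s', s'.1 12 = (s.1 12)./2./2 &
                    s'.1 8 = s.1 8 - 1]) s.
Proof.
case: s => r m en hs.
apply: (@wp_le _ (4 + (9 + (6 + (15 + 1))))) => //.
apply: (@wp_block_seq code_bit) => //.
set s1 := foldl _ _ _; set y := (r, m).1 12.
have h1 : holds st s1 by apply: holds_ext hs => // -[|[|[|[|[|[|[|[|[|[|[|[|[|[|[|[|[|[|[|d]]]]]]]]]]]]]]]]]]].
have e1 : env s1 by [].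
have bit z : z - z./2 - z./2 = odd z by lia.
have s1_20 : s1.1 20 = odd y by rewrite -bit.
have s1_12 : s1.1 12 = y./2 by [].
have s1_8 : s1.1 8 = r 8 by [].
move: s1 h1 e1 s1_20 s1_12 s1_8 => s1 h1 e1 s1_20 s1_12 s1_8.
apply: (wp_seq (T1 := 9) (R := fun s' => holds (if odd y then use_clique st else st) s')).
  apply: wp_if; rewrite s1_20; case: odd => // _.
  by apply: (@wp_block code_use) => //; apply: holds_use.
move=> [r2 m2] ag2 h2.
have e2 := env_agree e1 ag2 isT.
have s2_12 : r2 12 = y./2 by rewrite -s1_12; apply: (ag2 12 isT).
have s2_8 : r2 8 = r 8 by rewrite -s1_8; apply: (ag2 8 isT).
apply: wp_block_seq => //.
set s3 := foldl _ _ _.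
have h3 : holds (next_vertex (if odd y then use_clique st else st)) s3.
  case: (if odd y then _ else _) h2 => W P v c mn mx bad.
  move=> [[/= lay h13 h14] [h15 h16 h17 h18]].
  have [/= _ _ _ e5 _] := e2.
  by split; rewrite /s3; run_code; rewrite ?e5 ?h13 ?h14 ?h15 ?addn1.
have e3 : env s3 by [].
have s3_20 : s3.1 20 = odd y./2 by rewrite -s2_12 -bit.
have s3_12 : s3.1 12 = y./2./2 by rewrite -s2_12.
have s3_8 : s3.1 8 = r 8 by [].
move: s3 h3 e3 s3_20 s3_12 s3_8 => s3 h3 e3 s3_20 s3_12 s3_8.
apply: (wp_seq (T1 := 15) (R := fun s' => holds (digit st y) s')).
  rewrite /digit; apply: wp_if; rewrite s3_20; case: odd => // _.
  by apply: (@wp_block code_close) => //; apply: holds_close.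
move=> [r4 m4] ag4 h4.
have [/= _ _ _ e5 _] := env_agree e3 ag4 isT.
apply: (@wp_block [:: _]) => //=; split.
- by apply: holds_ext h4 => // d dh; rewrite /= /set_reg -[eqn d 8]/(d == 8) ifF //; lia.
- by run_code; rewrite -s3_12; apply: (ag4 12 isT).
- by run_code; rewrite e5 -s3_8; congr (_ - _); apply: (ag4 8 isT).
Qed.

Lemma wp_scan_digits s W : env s -> layout s.2 W ->
  wp scan_digits (k * 37 + 9) (holds (scan k (start n W) (s.1 3))) s.
Proof.
case: s => r m [/= e0 e1 e2 e5 e6] lay.
apply: (@wp_le _ (8 + (k * 37).+1)); first by lia.
apply: (@wp_block_seq [:: _; _; _; _; _; _; _; _]) => //.
set s0 := foldl _ _ _.
have env0 : env s0 by [].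
have s08 : s0.1 8 = k by [].
have s012 : s0.1 12 = r 3 by [].
have h0 : holds (start n W) s0 by [].
move: s0 env0 s08 s012 h0 => s0 env0 s08 s012 h0.
rewrite -{1}s08.
pose I j (s : store) := exists2 st, holds st s &
  scan j st (s.1 12) = scan k (start n W) (r 3).
apply: (@wp_conseq _ _ (I 0)); first by move=> s' _ [st hs /= <-].
apply: wp_for; last by exists (start n W); rewrite ?s08 ?s012.
move=> j s [st hs Es] s8 ag.
have env1 := env_agree env0 ag isT.
apply: wp_conseq (wp_digit env1 hs) => s' _ [h' s12 s'8].
by split; [exists (digit st (s.1 12)); rewrite ?s12|rewrite s'8 s8 subn1].
Qed.

Lemma wp_find_extremes st s : env s -> holds st s ->
  wp find_extremes (n * 10 + 2)
    (fun s' => let e := extremes (vW st) (vmn st) (vmx st) n in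
       [/\ s'.2 = s.2, s'.1 16 = e.1 & s'.1 17 = e.2]) s.
Proof.
case: s => r m [/= e0 e1 e2 e5 e6] [[/= lay h13 h14] [h15 h16 h17 h18]].
apply: (@wp_le _ (1 + (n * 10).+1)); first by lia.
apply: wp_block_seq => //.
set s0 := foldl _ _ _.
have env0 : env s0 by [].
have s08 : s0.1 8 = n by [].
rewrite -{1}s08.
pose I j (s : store) := s.2 = m /\
  extremes (vW st) (s.1 16) (s.1 17) j = extremes (vW st) (vmn st) (vmx st) n.
apply: (@wp_conseq _ _ (I 0)); first by move=> s' _ [-> <-].
apply: wp_for; last by split=> //; rewrite s08 /s0; run_code; rewrite h16 h17.
move=> j [r' m'] [/= -> Ej] /= r8 ag.
have env1 := env_agree env0 ag isT.
have [/= a0 a1 a2 a5 a6] := env1.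
apply: (@wp_le _ (2 + (5 + 1))) => //.
apply: (@wp_block_seq [:: _; _]) => //.
set s1 := foldl _ _ _.
have s1_11 : s1.1 11 = vW st j.+1.
  by rewrite /s1; run_code; rewrite r8 a6; have [_ ->] := lay.
apply: (wp_seq (R := I j)).
  apply: wp_if; rewrite s1_11 => Wj.
    apply: (@wp_block [:: _; _; _; _]) => //=; split=> //=.
    by run_code; rewrite r8 -Ej (negPf Wj) minnE maxnE.
  by split=> //; rewrite /s1; run_code; rewrite -Ej Wj.
move=> [r2 m2] ag2 [/= E2 E3].
have r28 : r2 8 = j.+1 by apply: etrans (ag2 8 isT) r8.
have r25 : r2 5 = 1 by apply: etrans (ag2 5 isT) a5.
apply: (@wp_block [:: _]) => //=.
by run_code; rewrite r28 r25 subn1; split=> //; split.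
Qed.

Lemma table_supported u : u <= n -> supported (table u).
Proof.
move=> un j jn; apply/count_memPn/negP => /mapP[v].
rewrite mem_iota => /andP[_ vu] ju; move: jn; rewrite ju row_size_le //; lia.
Qed.

Lemma use_supported st : supported (vW st) -> supported (vW (use_clique st)).
Proof.
case: st => W P s c mn mx bad /= sup j jn; rewrite /upd; case: eqP => [E|_]; last exact: sup.
by rewrite -E sup.
Qed.

Lemma digit_supported st y : supported (vW st) -> supported (vW (digit st y)).
Proof.
move=> sup; rewrite /digit.
set st1 := next_vertex _.
have sup1 : supported (vW st1).
  have E st' : vW (next_vertex st') = vW st' by case: st'.
  by rewrite E; case: odd => //; apply: use_supported.
case: odd => //.
have -> : vW (close_group st1) = vW (use_clique st1).
  by rewrite /close_group; case: use_clique.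
exact: use_supported.
Qed.

Lemma scan_supported j st y : supported (vW st) -> supported (vW (scan j st y)).
Proof. by elim: j st y => //= j IH st y sup; apply/IH/digit_supported. Qed.

Definition verify_time : nat := n * (n * 6 + 26) + k * 37 + 25.

Lemma wp_verify s W : env s -> layout s.2 W -> supported W ->
  wp verify verify_time
    (fun s' => (exists2 W', layout s'.2 W' & supported W') /\
       s'.1 4 = if accepts n k eta (table n) (s.1 3) then 1 else s.1 4) s.
Proof.
move=> en lay sup.
apply: (@wp_le _ (n * 6 + 2 + (n * (n * 6 + 10) + 3 + (k * 37 + 9 +
  (n * 10 + 2 + (7 + 2)))))); first by rewrite /verify_time; lia.
apply: (wp_seq (wp_clear_table en lay sup)) => s1 ag1 lay1.
have en1 := env_agree en ag1 isT.
apply: (wp_seq (wp_fill_table en1 lay1)) => s2 ag2 lay2.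
have en2 := env_agree en1 ag2 isT.
apply: (wp_seq (wp_scan_digits en2 lay2)) => s3 ag3.
have -> : s2.1 3 = s.1 3 by rewrite (ag2 3 isT) (ag1 3 isT).
set st := scan _ _ _ => h3.
have en3 := env_agree en2 ag3 isT.
apply: (wp_seq (wp_find_extremes en3 h3)) => s4 ag4 [E4 m4 x4].
have [e0 e1 e2 e5 e6] := env_agree en3 ag4 isT.
have s4_4 : s4.1 4 = s.1 4.
  by rewrite (ag4 4 isT) (ag3 4 isT) (ag2 4 isT) (ag1 4 isT).
case: h3 => -[lay3 h13 _] [h15 _ _ h18].
rewrite -(ag4 13 isT) in h13; rewrite -(ag4 15 isT) in h15; rewrite -(ag4 18 isT) in h18.
rewrite -E4 in lay3.
case: s4 {ag4 E4} m4 x4 e0 e1 e2 e5 e6 s4_4 h13 h15 h18 lay3 => r4 m /=.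
move=> m4 x4 e0 e1 e2 e5 e6 s4_4 h13 h15 h18 lay3.
have sup3 : supported (vW st).
  by apply: scan_supported; apply: table_supported.
apply: (@wp_block_seq [:: _; _; _; _; _; _; _]) => //.
set s5 := foldl _ _ _.
have s5_11 : (s5.1 11 != 0) = accepts n k eta (table n) (s.1 3).
  rewrite /s5; run_code; rewrite h13 h15 h18 m4 x4 e1 e2 e5 /accepts -/st.
  by rewrite -lt0n subn_gt0 ltnS leqn0.
have s5_4 : s5.1 4 = s.1 4 by [].
have s5_2 : layout s5.2 (vW st) by [].
move: s5 s5_11 s5_4 s5_2 => s5 s5_11 s5_4 s5_2.
apply: wp_if => [|s50].
  rewrite s5_11 => acc; case: s5 {s5_11 s5_4} s5_2 => r5 m5 lay5.
  apply: (@wp_block [:: _]) => //; run_code; rewrite acc; split=> //.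
  by exists (vW st).
rewrite -s5_11 s50 s5_4; split=> //; by exists (vW st).
Qed.

Lemma wp_solver m : layout m (fun=> 0) ->
  wp solver (n * 4 + k * 5 + 8 + 4 ^ k * (verify_time + 3))
    (fun s' => s'.1 0 = [exists y : 'I_(4 ^ k), accepts n k eta (table n) y])
    (nth 0 [:: n; k; eta], m).
Proof.
move=> lay.
apply: (@wp_le _ (2 + ((n * 4).+1 + (2 + ((k * 5).+1 +
  ((4 ^ k * (1 + verify_time).+2).+1 + 1)))))).
  by rewrite (_ : (1 + _).+2 = verify_time + 3); lia.
apply: (@wp_block_seq [:: _; _]) => //.
set s0 := foldl _ _ _.
have s08 : s0.1 8 = n by [].
rewrite -{1}s08.
pose I1 j (s : store) := s.2 = m /\ s.1 6 + j * n = n * n.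
apply: (wp_seq (R := I1 0)).
  apply: wp_for; last by split=> //; rewrite s08.
  move=> j [r' m'] [/= -> E6] /= r8 ag.
  have a5 : r' 5 = 1 by apply: (ag 5 isT).
  have a0 : r' 0 = n by apply: (ag 0 isT).
  apply: (@wp_block [:: _; _]) => //; run_code; rewrite a5 r8 subn1; split=> //.
  by split=> //; run_code; rewrite a0 -E6; lia.
move=> [r1 m1] ag1 [/= -> E6].
apply: (@wp_block_seq [:: _; _]) => //.
set s2 := foldl _ _ _.
have en2 : env s2.
  split; rewrite /s2; run_code.
  - exact: (ag1 0 isT).
  - exact: (ag1 1 isT).
  - exact: (ag1 2 isT).
  - exact: (ag1 5 isT).
  - by rewrite -E6 mul0n addn0.
have s2_4 : s2.1 4 = 0 by apply: (ag1 4 isT).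
have s28 : s2.1 8 = k by apply: (ag1 1 isT).
have s23 : s2.1 3 = 1 by [].
have m2 : s2.2 = m by [].
move: s2 en2 s2_4 s28 s23 m2 => s2 en2 s2_4 s28 s23 m2.
rewrite -{1}s28.
pose I2 j (s : store) := s.2 = m /\ s.1 3 * 4 ^ j = 4 ^ k.
apply: (wp_seq (R := I2 0)).
  apply: wp_for; last by split=> //; rewrite s28 s23 mul1n.
  move=> j [r' m'] [/= -> E3] /= r8 ag.
  have [/= a0 a1 a2 a5 a6] := env_agree en2 ag isT.
  apply: (@wp_block [:: _; _; _]) => //; run_code; rewrite a5 r8 subn1; split=> //.
  by split=> //; run_code; rewrite -E3 expnS; lia.
move=> s3 ag3 [m3 E3]; rewrite expn0 muln1 in E3.
have en3 := env_agree en2 ag3 isT.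
have s3_4 : s3.1 4 = 0 by rewrite (ag3 4 isT).
rewrite -{1}E3.
pose acc y := accepts n k eta (table n) y.
(* The counter descends, so at value [j] the certificates from [j] on have been tried. *)
pose I3 j (s : store) := [/\ j <= 4 ^ k,
  (exists2 W, layout s.2 W & supported W) & s.1 4 = has acc (iota j (4 ^ k - j))].
apply: (wp_seq (R := I3 0)).
  apply: wp_for; last first.
    by rewrite /I3 E3 subnn s3_4 m3; split=> //; exists (fun=> 0).
  move=> j [r' m'] [jk [W lW sW] E4] /= r3 ag.
  have [/= a0 a1 a2 a5 a6] := env_agree en3 ag isT.
  apply: (@wp_block_seq [:: _]) => //.
  set s4 := foldl _ _ _.
  have en4 : env s4 by [].
  have s43 : s4.1 3 = j by rewrite /s4; run_code; rewrite a5 r3 subn1.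
  apply: wp_conseq (@wp_verify s4 W en4 lW sW) => s5 ag5 [H5 s54].
  split; last by rewrite (ag5 3 isT).
  split=> //; first exact: ltnW.
  rewrite s54 s43 -/(acc j).
  rewrite (_ : 4 ^ k - j = (4 ^ k - j.+1).+1); last by lia.
  by rewrite /= -/(acc j); case: (acc j) => //=; apply: E4.
move=> [r6 m6] ag6 [_ _ /= r64].
apply: (@wp_block [:: _]) => //=; run_code; rewrite r64 subn0.
congr nat_of_bool; apply/hasP/existsP => [[y]|[y accy]].
  by rewrite mem_iota => /andP[_ yk] accy; exists (Ordinal yk).
by exists (val y) => //; rewrite mem_iota /=.
Qed.
End Verification.

(** * Completions and mergings *)

(** This carries a grouping of sizes back to a grouping of the components that have them. *)
Lemma perm_map_lift (T1 T2 : eqType) (f : T1 -> T2) (s : seq T2) (L : seq T1) :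
  perm_eq s (map f L) -> exists2 L', perm_eq L' L & map f L' = s.
Proof.
elim: s L => [|x s IH] L pe.
  by exists [::] => //; case: L pe => // a l /perm_size.
have /mapP[y yL xy] : x \in map f L by rewrite -(perm_mem pe) mem_head.
have pL := perm_to_rem yL.
have [|L' pL' <-] := IH (rem y L).
  by rewrite -(perm_cons x) (perm_trans pe) // xy -map_cons perm_map.
by exists (y :: L'); rewrite /= ?xy // perm_sym (perm_trans pL) // perm_cons perm_sym.
Qed.

Lemma uniq_flatten_inj (T : eqType) (ss : seq (seq T)) g h x :
  uniq (flatten ss) -> g \in ss -> h \in ss -> x \in g -> x \in h -> g = h.
Proof.
elim: ss => //= a ss IH; rewrite cat_uniq => /and3P[_ /hasPn dis us].
have nin b : b \in ss -> x \in b -> x \in a -> False.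
  by move=> bs xb; apply/negP/dis; apply/flattenP; exists b.
rewrite !inE => /predU1P[->|gs] /predU1P[->|hs] // xg xh; last exact: IH xg xh.
- by case: (nin h).
- by case: (nin g).
Qed.

Lemma perm_fibers (T U : eqType) (f : T -> U) (L : seq T) :
  perm_eq (flatten [seq [seq x <- L | f x == y] | y <- undup (map f L)]) L.
Proof.
apply/permP => a; rewrite count_flatten -map_comp sumnE big_map.
under eq_bigr => y _ do rewrite /= count_filter -sum1_count big_mkcond.
rewrite exchange_big /= -sum1_count big_mkcond [RHS]big_mkcond.
apply: eq_big_seq => x xL.
rewrite (bigD1_seq (f x)) ?undup_uniq ?mem_undup ?map_f //= eqxx andbT.
by rewrite big1 ?addn0 // => y; rewrite eq_sym => /negPf ->; rewrite andbF.
Qed.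

Local Notation root := fingraph.root.

(** * Component sizes and sums over vertices *)

Section GraphSizes.
Variables (T : finType) (G : sgraph T).

Definition comp_size (u : T) : nat := #|[set v | connect G u v]|.
Definition degree (u : T) : nat := #|[set v | adj G u v]|.

Lemma adj_connect_sym : connect_sym G.
Proof. exact: sym_connect_sym (@adj_sym T G). Qed.

Lemma cluster_connect u v : cluster_graph G -> connect G u v = (u == v) || adj G u v.
Proof.
move=> cl; apply/idP/orP => [uv|[/eqP->|/connect1]] //.
case: (eqVneq u v) => [|ne]; [by left|right].
apply: (cl [set w | connect G u w]) => //; last by rewrite inE.
- by apply/imsetP; exists u.
- by rewrite inE connect0.
Qed.

Lemma cluster_comp_size u : cluster_graph G -> comp_size u = (degree u).+1.
Proof.
move=> cl; rewrite /comp_size (_ : [set v | _] = u |: [set v | adj G u v]).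
  by rewrite cardsU1 inE adj_irr.
by apply/setP=> v; rewrite !inE cluster_connect // eq_sym.
Qed.

Definition comp_roots : seq T := [seq r <- enum T | root G r == r].
Definition comp_sizes : seq nat := map comp_size comp_roots.

Lemma comp_size_root u : comp_size (root G u) = comp_size u.
Proof.
apply: eq_card => v; rewrite !inE.
by rewrite -(same_connect adj_connect_sym (connect_root G u)).
Qed.

Lemma root_in u : root G u \in comp_roots.
Proof. by rewrite mem_filter mem_enum (root_root adj_connect_sym) eqxx. Qed.

(** Vertices are regrouped by the root of their component. Suitable [h] give the number of vertices,
    the sum of squares and the multiplicities of the sizes. *)
Lemma sum_roots (h : T -> nat) :
  \sum_u h (root G u) = \sum_(r <- comp_roots) comp_size r * h r.
Proof.
rewrite (partition_big (root G) (fun r => root G r == r)) /=; last first.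
  by move=> u _; rewrite (root_root adj_connect_sym).
rewrite big_filter big_enum_cond /=; apply: eq_big => [r|r /eqP rr] //.
rewrite (eq_bigr (fun=> h r)) => [|u /eqP -> //].
rewrite sum_nat_const; congr (_ * _); apply: eq_card => u.
by rewrite [RHS]inE adj_connect_sym -(root_connect adj_connect_sym) rr.
Qed.

Lemma comp_sizes_gt0 : all (leq 1) comp_sizes.
Proof.
apply/allP=> _ /mapP[r _ ->]; apply/card_gt0P; exists r.
by rewrite inE connect0.
Qed.

Lemma sumn_comp_sizes : sumn comp_sizes = #|T|.
Proof.
rewrite sumnE big_map -sum1_card (sum_roots (fun=> 1)).
by apply: eq_bigr => r _; rewrite muln1.
Qed.

Lemma sqsum_comp_sizes : sqsum comp_sizes = \sum_u comp_size u.
Proof.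
rewrite /sqsum sumnE !big_map -sum_roots.
by apply: eq_bigr => u _; rewrite comp_size_root.
Qed.

Lemma card_comp_size j :
  \sum_u (comp_size u == j) = j * count_mem j comp_sizes.
Proof.
transitivity (\sum_u (comp_size (root G u) == j)).
  by apply: eq_bigr => u _; rewrite comp_size_root.
rewrite (sum_roots (fun u => comp_size u == j)) count_map -sum1_count big_distrr /=.
rewrite [RHS]big_mkcond; apply: eq_bigr => r _.
by case: eqP => [->|]; rewrite ?muln0.
Qed.

Section Labelling.
Variables (U : eqType) (lab : T -> U).

Definition class_size (u : T) : nat := #|[set v | lab v == lab u]|.

Hypothesis lab_root : forall u, lab (root G u) = lab u.

Lemma class_size_root u :
  class_size u = \sum_(r <- comp_roots | lab r == lab u) comp_size r.
Proof.
rewrite /class_size -sum1_card big_mkcond.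
transitivity (\sum_v (lab (root G v) == lab u)).
  by apply: eq_bigr => v _; rewrite inE lab_root; case: eqP.
rewrite (sum_roots (fun v => lab v == lab u)) [RHS]big_mkcond.
by apply: eq_bigr => r _; case: eqP => _; rewrite ?muln1 ?muln0.
Qed.

Lemma sum_class_sizes gss :
  perm_eq (flatten gss) comp_roots ->
  (forall g r, g \in gss -> r \in g -> class_size r = sumn (map comp_size g)) ->
  sqsum (map sumn (map (map comp_size) gss)) = \sum_u class_size u.
Proof.
move=> pe Hg.
transitivity (\sum_u class_size (root G u)); last first.
  by apply: eq_bigr => u _; rewrite /class_size lab_root.
rewrite sum_roots -(perm_big _ pe) /= big_flatten /sqsum sumnE !big_map.
apply: eq_big_seq => g gg /=; rewrite [sumn _ in X in X * _]sumnE big_map big_distrl /=.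
by apply: eq_big_seq => r rg; rewrite (Hg g).
Qed.

End Labelling.
End GraphSizes.

(** * Counting added edges, and the equivalence of completions and mergings *)

Section Completion.
Variables (T : finType) (G : sgraph T) (k eta : nat).
Hypothesis clG : cluster_graph G.

(** Double counting of the pairs of a vertex and a member of [F] containing it. *)
Lemma sum_new_degree (F : {set {set T}}) : F \subset nonedges G ->
  \sum_u #|[set v | (u != v) && ([set u; v] \in F)]| = #|F|.*2.
Proof.
move=> sF.
have FP e : e \in F -> exists a b, a != b /\ e = [set a; b].
  move/(subsetP sF)/imsetP => [[a b]]; rewrite inE => /andP[ab _] ->.
  by exists a, b.
transitivity (\sum_u \sum_(e in F) (u \in e)).
  apply: eq_bigr => u _.
  have -> : \sum_(e in F) (u \in e) = #|[set e in F | u \in e]|.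
    by rewrite -sum1dep_card big_mkcondr; apply: eq_bigr => e _; case: (u \in e).
  rewrite -(card_in_imset (f := fun v => [set u; v])).
    apply: eq_card => e; rewrite [RHS]inE; apply/imsetP/andP.
      by move=> [v]; rewrite inE => /andP[uv vF] ->; rewrite vF !inE eqxx.
    case=> eF; have [a [b [ab Ee]]] := FP e eF; rewrite Ee !inE.
    case/orP=> /eqP Eu; subst u; [exists b | exists a] => //.
    - by rewrite inE ab -Ee.
    - by rewrite inE eq_sym ab setUC -Ee.
    - by rewrite setUC.
  move=> v w; rewrite !inE => /andP[uv _] /andP[uw _] /setP/(_ v).
  by rewrite !inE eqxx orbT eq_sym (negPf uv) /= => /esym/eqP.
rewrite exchange_big /= -muln2 -sum_nat_const; apply: eq_bigr => e eF.
have [a [b [ab ->]]] := FP e eF.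
by rewrite -big_mkcond sum1_card cards2 ab.
Qed.

Lemma degree_add_edges (F : {set {set T}}) u : F \subset nonedges G ->
  degree (add_edges G F) u = degree G u + #|[set v | (u != v) && ([set u; v] \in F)]|.
Proof.
move=> sF; rewrite /degree -cardsUI.
rewrite [_ :&: _](_ : _ = set0) ?cards0 ?addn0.
  by apply: eq_card => v; rewrite !inE.
apply/setP=> v; rewrite !inE; apply/negP => /and3P[Guv uv /(subsetP sF)].
case/imsetP=> [[a b]]; rewrite inE /= => /andP[ab nG] E.
have := E; move/setP/(_ u); rewrite !inE eqxx => /esym/orP[]/eqP Eu; subst u.
- move: E => /setP/(_ v); rewrite !inE eqxx orbT eq_sym (negPf uv) /= => /esym/eqP Ev.
  by rewrite -Ev Guv in nG.
- move: E => /setP/(_ v); rewrite !inE eqxx orbT orbC eq_sym (negPf uv) /= => /esym/eqP Ev.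
  by rewrite -Ev adj_sym Guv in nG.
Qed.

Lemma sum_comp_size_add (F : {set {set T}}) : F \subset nonedges G -> cluster_graph (add_edges G F) ->
  \sum_u comp_size (add_edges G F) u = \sum_u comp_size G u + #|F|.*2.
Proof.
move=> sF clH; rewrite -sum_new_degree // -big_split /=; apply: eq_bigr => u _.
by rewrite !cluster_comp_size // degree_add_edges.
Qed.

Lemma merging_of_completion : balanced_cluster_completion G k eta ->
  exists gs, merging (comp_sizes G) k eta gs.
Proof.
case=> F [sF Fk clH bal].
(* Components of [G] are grouped by the component of [H] that contains them. *)
pose H := add_edges G F; pose lab := root H.
have lab_root u : lab (root G u) = lab u.
  apply/esym/eqP; rewrite (root_connect (adj_connect_sym H)).
  apply: connect_sub (connect_root G u) => a b Gab; apply: connect1.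
  by rewrite /= /add_rel Gab.
have cls u : class_size lab u = comp_size H u.
  apply: eq_card => v; rewrite !inE (root_connect (adj_connect_sym H)).
  exact: (adj_connect_sym H).
pose L := comp_roots G.
pose gss := [seq [seq r <- L | lab r == y] | y <- undup (map lab L)].
have pe : perm_eq (flatten gss) L by apply: perm_fibers.
have gssP g r : g \in gss -> r \in g -> class_size lab r = sumn (map (comp_size G) g).
  case/mapP=> y _ ->; rewrite mem_filter => /andP[/eqP <- rL].
  by rewrite (class_size_root lab_root) sumnE big_map big_filter.
have gss0 g : g \in gss -> exists r, r \in g.
  case/mapP=> y; rewrite mem_undup => /mapP[r rL ->] ->; exists r.
  by rewrite mem_filter eqxx.
exists (map (map (comp_size G)) gss); split.
- by rewrite -map_flatten perm_map.
- by apply/mapP => -[g /gss0[r]]; case: g.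
- rewrite (sum_class_sizes lab_root pe gssP) sqsum_comp_sizes.
  rewrite (eq_bigr (comp_size H)) => [|u _]; last exact: cls.
  by rewrite sum_comp_size_add // leq_add2l leq_double.
move=> _ _ /mapP[g gg ->] /mapP[h hh ->].
have [a ag] := gss0 _ gg; have [b bh] := gss0 _ hh.
rewrite -(gssP _ _ gg ag) -(gssP _ _ hh bh) !cls.
have comp u : [set v | connect H u v] \in components H by apply/imsetP; exists u.
have := bal _ _ (comp a) (comp b); rewrite /comp_size.
by move: #|_| #|_| => x y; lia.
Qed.

(** Adding every missing pair inside a label class turns the classes into the components. *)
Lemma completion_of_labelling (U : eqType) (lab : T -> U) :
  (forall u v, adj G u v -> lab u = lab v) ->
  \sum_u class_size lab u <= \sum_u comp_size G u + k.*2 ->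
  (forall u v, class_size lab u <= class_size lab v + eta) ->
  balanced_cluster_completion G k eta.
Proof.
move=> labG cost bal.
pose F := [set [set p.1; p.2] | p : T * T &
  [&& p.1 != p.2, ~~ adj G p.1 p.2 & lab p.1 == lab p.2]].
have sF : F \subset nonedges G.
  apply/subsetP=> e /imsetP[p]; rewrite inE => /and3P[p1 p2 _] ->.
  by apply/imsetP; exists p => //; rewrite inE p1 p2.
pose H := add_edges G F.
have HE u v : adj H u v = (u != v) && (lab u == lab v).
  rewrite /= /add_rel; case: (eqVneq u v) => [->|uv] /=; first by rewrite adj_irr.
  case Guv: (adj G u v) => /=; first by rewrite (labG _ _ Guv) eqxx.
  apply/imsetP/idP => [[[a b]]|labuv]; last first.
    by exists (u, v) => //; rewrite inE uv Guv labuv.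
  rewrite inE /= => /and3P[ab _ /eqP lab_ab] /setP E.
  have lab_e w : w \in [set u; v] -> lab w = lab a.
    by rewrite E !inE => /orP[]/eqP->.
  by rewrite !lab_e // !inE eqxx ?orbT.
have HC u v : connect H u v = (lab v == lab u).
  apply/idP/eqP => [|E]; last first.
    case: (eqVneq u v) => [->|uv]; first exact: connect0.
    by apply: connect1; rewrite -[Defs.adj _ _ _]/(adj H u v) HE uv E eqxx.
  case/connectP=> p; elim: p u => [|w p IH] u /= => [_ ->//|/andP[uw pw] Ev].
  rewrite (IH _ pw Ev); apply/esym/eqP.
  by move: uw; rewrite -[add_rel _ _ _ _]/(adj H u w) HE => /andP[].
have cls u : class_size lab u = comp_size H u.
  by apply: eq_card => v; rewrite !inE HC.
have clH : cluster_graph H.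
  move=> _ /imsetP[w _ ->] u v; rewrite !inE !HC => /eqP Eu /eqP Ev uv.
  by rewrite HE uv Eu Ev eqxx.
exists F; split=> //.
  (* The size of [F] is not counted directly but read off from the handshake identity. *)
  rewrite -leq_double -(leq_add2l (\sum_u comp_size G u)) -sum_comp_size_add //.
  by rewrite -(eq_bigr _ (fun u _ => cls u)).
move=> _ _ /imsetP[u _ ->] /imsetP[v _ ->].
rewrite -!/(comp_size _ _) -!cls; have := bal u v; have := bal v u.
by move: (class_size lab u) (class_size lab v) => x y; lia.
Qed.

Lemma completion_of_merging gs : merging (comp_sizes G) k eta gs ->
  balanced_cluster_completion G k eta.
Proof.
case=> pe n0 cost bal.
have [L' pL' EL'] := perm_map_lift pe.
pose gss := reshape (shape gs) L'.
have Egs : map (map (comp_size G)) gss = gs by rewrite map_reshape EL' flattenK.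
have fl : flatten gss = L'.
  by rewrite reshapeKr // -(size_map (comp_size G)) EL' size_flatten.
have pg : perm_eq (flatten gss) (comp_roots G) by rewrite fl.
have uL : uniq (comp_roots G) by rewrite filter_uniq ?enum_uniq.
have ug : uniq (flatten gss) by rewrite (perm_uniq pg).
(* Labels are lists of roots rather than of sizes: roots do not repeat, so groups with equal sizes
   keep distinct labels. *)
pose group r := nth [::] gss (find (fun g : seq T => r \in g) gss).
have groupP r : r \in comp_roots G -> group r \in gss /\ r \in group r.
  rewrite -(perm_mem pg) => /flattenP[g gg rg].
  have hs : has (fun g : seq T => r \in g) gss by apply/hasP; exists g.
  by rewrite /group mem_nth -?has_find // (nth_find [::] hs).
have group_eq r g : g \in gss -> r \in g -> group r = g.
  move=> gg rg; have rr : r \in comp_roots G.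
    by rewrite -(perm_mem pg); apply/flattenP; exists g.
  by have [g1 g2] := groupP _ rr; apply: uniq_flatten_inj ug g1 gg g2 rg.
pose lab u := group (root G u).
have lab_root u : lab (root G u) = lab u.
  by rewrite /lab (root_root (adj_connect_sym G)).
have labr r : r \in comp_roots G -> lab r = group r.
  by rewrite mem_filter /lab => /andP[/eqP ->].
have gssP g r : g \in gss -> r \in g -> class_size lab r = sumn (map (comp_size G) g).
  move=> gg rg; have rr : r \in comp_roots G.
    by rewrite -(perm_mem pg); apply/flattenP; exists g.
  rewrite (class_size_root lab_root) sumnE big_map labr // (group_eq _ g) //.
  rewrite -big_filter; apply: perm_big; apply: uniq_perm.
  - exact: filter_uniq.
  - have : subseq g (flatten gss).
      elim: (gss) gg => //= a l IH; rewrite inE => /predU1P[->|/IH sg]; first exact: prefix_subseq.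
      exact: subseq_trans sg (suffix_subseq _ _).
    by move/subseq_uniq; apply.
  move=> x; rewrite mem_filter; apply/andP/idP => [[/eqP lx xr]|xg].
    by rewrite -lx labr //; case: (groupP _ xr).
  have xr : x \in comp_roots G by rewrite -(perm_mem pg); apply/flattenP; exists g.
  by rewrite labr // (group_eq _ g).
have cls_root u : class_size lab (root G u) = class_size lab u by rewrite /class_size lab_root.
have sum_in u : exists2 g, g \in gs & class_size lab u = sumn g.
  have [g1 g2] := groupP _ (root_in G u).
  exists (map (comp_size G) (group (root G u))); last by rewrite -cls_root (gssP _ _ g1 g2).
  by rewrite -Egs map_f.
apply: (@completion_of_labelling _ lab).
- move=> u v Guv; rewrite /lab.
  by have /(fingraph.rootP (adj_connect_sym G)) -> : connect G u v by apply: connect1.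
- by rewrite -(sum_class_sizes lab_root pg gssP) Egs -sqsum_comp_sizes.
- move=> u v; have [g gg ->] := sum_in u; have [h hh ->] := sum_in v.
  exact: bal.
Qed.

End Completion.

(** * Running time and correctness *)

Import Order.TTheory GRing.Theory Num.Theory.

(** One plus the logarithm pays for the factor [k.+1]. The other 4 is the exponent of [256 = 4 ^ 4],
    the first power of four above 72, the sum of the coefficients without [k] in the running
    time. *)
Definition overhead (k : nat) : nat := trunc_log 2 k.+1 + 5.

Lemma overhead_exp k : k.+1 * 256 <= 4 ^ overhead k.
Proof.
have /andP[_ lt] := trunc_log_bounds (isT : 1 < 2) (ltn0Sn k).
rewrite /overhead -addSnnS expnD leq_mul // (leq_trans (ltnW lt)) //.
by rewrite leq_exp2r.
Qed.

(** A logarithm [l] up to [2N + 10] is covered by the hypothesis. Beyond that, [N * (l + 5) <= N * 2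
    ^ (l - N) < 2 ^ l <= k + 1]. *)
Lemma overhead_small N k : N * (N.*2 + 15) <= k -> N * overhead k <= k.
Proof.
move=> Nk; rewrite /overhead; set l := trunc_log 2 k.+1.
have le2 : 2 ^ l <= k.+1 by apply: trunc_logP.
have [lN|Nl] := leqP l (N.*2 + 10).
  by apply: leq_trans Nk; rewrite leq_mul2l; lia.
have x0 : 2 * (l - N) <= 2 ^ (l - N).
  have -> : l - N = (l - N).-1.+1 by lia.
  by rewrite expnS leq_mul2l /= ltn_expl.
have lx : N * (l + 5) <= N * 2 ^ (l - N) by rewrite leq_mul2l; lia.
have NN : N < 2 ^ N by apply: ltn_expl.
have : N * 2 ^ (l - N) < 2 ^ l.
  rewrite -{2}(subnKC (_ : N <= l)); last by lia.
  by rewrite expnD ltn_mul2r expn_gt0.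
by lia.
Qed.

Lemma overhead_little_o : little_o_id overhead.
Proof.
move=> eps e0; pose N := Num.bound (eps^-1)%R.
have eN : (1 <= eps * N%:R)%R.
  have /ltW/(ler_wpM2l (ltW e0)) : (eps^-1 < N%:R)%R by apply: archi_boundP; rewrite invr_ge0 ltW.
  by rewrite mulfV ?lt0r_neq0.
exists (N * (N.*2 + 15)) => k /overhead_small Nk.
apply: (@le_trans _ _ (eps * (N * overhead k)%:R)%R).
  by rewrite natrM mulrA ler_peMl.
by rewrite ler_pM2l // ler_nat.
Qed.

(** * The adjacency matrix of a cluster graph as machine input *)

Section Input.
Variables (n : nat) (G : sgraph 'I_n).
Hypothesis clG : cluster_graph G.

Definition matrix_cells (a : nat) : nat :=
  [exists u : 'I_n, exists v : 'I_n, (a == u * n + v) && adj G u v].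

Lemma cell_lt (u v : 'I_n) : u * n + v < n * n.
Proof. by have := ltn_ord u; have := ltn_ord v; nia. Qed.

Lemma matrix_cells_adj (u v : 'I_n) : matrix_cells (u * n + v) = adj G u v.
Proof.
congr nat_of_bool; apply/existsP/idP => [[u' /existsP[v' /andP[/eqP E Guv]]]|Guv].
  have n0 : 0 < n by apply: leq_ltn_trans (ltn_ord u).
  have Eu : u = u'.
    by apply: val_inj; have := congr1 (divn^~ n) E; rewrite /= !divnMDl // !divn_small // !addn0.
  subst u'; have -> // : v = v' by apply: val_inj; move/addnI: E.
by exists u; apply/existsP; exists v; rewrite eqxx.
Qed.

Lemma layout_input : layout n matrix_cells matrix_cells (fun=> 0).
Proof.
split=> // j; rewrite /matrix_cells; case: existsP => // -[u /existsP[v /andP[/eqP E _]]].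
by have := cell_lt u v; rewrite -E; lia.
Qed.

Lemma row_size_comp (u : 'I_n) : row_size n matrix_cells u = comp_size G u.
Proof.
rewrite cluster_comp_size // /row_size /degree; congr _.+1.
rewrite -sum1_card [RHS]big_mkcond; apply: eq_bigr => v _.
by rewrite matrix_cells_adj inE; case: adj.
Qed.

Lemma row_size_le u : u < n -> row_size n matrix_cells u <= n.
Proof.
move=> un; rewrite (row_size_comp (Ordinal un)).
by apply: leq_trans (max_card _) _; rewrite card_ord.
Qed.

(** Each of the [j] vertices of a clique of size [j] has row size [j]. *)
Lemma table_comp j :
  table n matrix_cells n j = j * count_mem j (comp_sizes G).
Proof.
rewrite -card_comp_size /table -val_enum_ord -map_comp count_map -sum1_count.
rewrite big_enum_cond big_mkcond /=; apply: eq_bigr => u _.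
by rewrite row_size_comp; case: eqP.
Qed.

Lemma accepts_completion k eta :
  [exists y : 'I_(4 ^ k), accepts n k eta (table n matrix_cells n) y] <->
  balanced_cluster_completion G k eta.
Proof.
have sn : sumn (comp_sizes G) = n by rewrite sumn_comp_sizes card_ord.
split=> [/existsP[y acc]|/(merging_of_completion clG)[gs mer]].
  have [gs] := accepts_sound table_comp (comp_sizes_gt0 G) sn acc.
  exact: completion_of_merging.
have [y yk acc] := accepts_complete table_comp (comp_sizes_gt0 G) sn mer.
by apply/existsP; exists (Ordinal yk).
Qed.

End Input.

Lemma solver_time n k :
  n * 4 + k * 5 + 8 + 4 ^ k * (verify_time n k + 3) <=
  4 ^ (k + overhead k) * maxn 1 n ^ 2.
Proof.
rewrite expnD -mulnA.
apply: (@leq_trans (4 ^ k * (n * 4 + k * 5 + 8 + (verify_time n k + 3)))).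
  by rewrite [X in _ <= X]mulnDr leq_add2r leq_pmull // expn_gt0.
rewrite leq_mul2l; apply/orP; right.
apply: (@leq_trans (k.+1 * 256 * maxn 1 n ^ 2)); last by rewrite leq_mul2r overhead_exp orbT.
have N1 : 0 < maxn 1 n by lia.
have nN : n <= maxn 1 n by lia.
rewrite /verify_time -mulnn; move: (maxn 1 n) N1 nN => N N1 nN.
have nn : n * n <= N * N by apply: leq_mul.
have N2 : N <= N * N by rewrite leq_pmulr.
have kN : k <= k * (N * N) by rewrite leq_pmulr // muln_gt0 N1.
nia.
Qed.

(* maxn 1 n only matters for the graph without vertices, where n ^ c would be 0.
   Constant factors are absorbed by f. *)
Theorem mainTheorem9 :
  exists (P : program) (f : nat -> nat) (c : nat),
    little_o_id f /\
    forall (n : nat) (G : sgraph 'I_n) (k eta : nat),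
      cluster_graph G ->
      exists (t : nat) (b : bool),
        [/\ t <= 4 ^ (k + f k) * maxn 1 n ^ c,
            answers_in P (input G k eta) t b
          & b <-> balanced_cluster_completion G k eta].
Proof.
exists (compile 0 solver), overhead, 2; split; first exact: overhead_little_o.
move=> n G k eta clG.
have [s [t [ex tT s0]]] :=
  wp_solver k eta (@row_size_le _ _ clG) (layout_input G).
exists t, [exists y : 'I_(4 ^ k), accepts n k eta (table n (matrix_cells G) n) y].
split; last exact: accepts_completion.
  exact: leq_trans tT (solver_time n k).
have := run_compile ex [::] [::]; rewrite cats0 /answers_in => -> /=.
(* The final program counter is the length of the code, where [nth] yields its default [IHalt]. *)
by split=> //; rewrite /halted /current nth_default // size_compile.
Qed.
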